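(* Let $m\ge1$ and $\kappa_m=\sqrt{\ln(4m)/\pi}$. The average number of edges of the minimal dag of an $m$-labeled unranked tree of size $n$, taken uniformly at random, satisfies $$\bar E^{\mathcal T}_{m,n}=3\kappa_m\frac{n}{\sqrt{\ln n}}\left(1+O\!\left(\frac1{\ln n}\right)\right)\quad(n\to\infty).$$
   Context: An $m$-labeled unranked tree is a non-empty finite rooted tree with node labels in $\{1,\dots,m\}$ and linearly ordered children (any finite number); its size is its number of edges. Its minimal dag has one node per distinct subtree (subtree = a node with all its descendants), and the node of a subtree $f(s_1,\dots,s_k)$ has $k$ ordered edges to the nodes of $s_1,\dots,s_k$; its number of edges is thus the sum over distinct subtrees of the number of children of their root. $\bar E^{\mathcal T}_{m,n}$ is the average of this number over all $m$-labeled unranked trees of size $n$. *)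

(* Defs.v *)
From Stdlib Require Import Reals List Arith Lia Bool.
Import ListNotations.
Open Scope R_scope.

(* Unranked ordered trees with nat labels (labels restricted to 1..m by the
   enumeration below). *)
Inductive tree : Type := Node : nat -> list tree -> tree.

(* size = number of edges *)
Fixpoint tsize (t : tree) : nat :=
  match t with
  | Node _ ts =>
      (fix go (ts : list tree) : nat :=
         match ts with nil => 0%nat | c :: r => (S (tsize c) + go r)%nat end) ts
  end.

Fixpoint labels_ok (m : nat) (t : tree) : Prop :=
  match t with
  | Node l ts => (1 <= l <= m)%nat /\
      (fix go (ts : list tree) : Prop :=
         match ts with nil => True | c :: r => labels_ok m c /\ go r end) ts
  end.

(* forests_f m fuel k : all ordered forests (lists of m-labeled trees) whose
   total size sum (tsize c + 1) equals k; correct whenever k <= fuel. *)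
Fixpoint forests_f (m fuel k : nat) : list (list tree) :=
  match fuel with
  | O => match k with O => [nil] | S _ => nil end
  | S f =>
      match k with
      | O => [nil]
      | S k' =>
          flat_map (fun s =>
            flat_map (fun t => map (cons t) (forests_f m f (k' - s)))
              (flat_map (fun l => map (Node l) (forests_f m f s)) (seq 1 m)))
            (seq 0 (S k'))
      end
  end.

(* The list of all m-labeled unranked trees of size n (each exactly once). *)
Definition trees (m n : nat) : list tree :=
  flat_map (fun l => map (Node l) (forests_f m n n)) (seq 1 m).

Fixpoint teqb (s t : tree) : bool :=
  match s, t with
  | Node a xs, Node b ys =>
      Nat.eqb a b &&
      (fix go (xs ys : list tree) : bool :=
         match xs, ys with
         | nil, nil => true
         | x :: xr, y :: yr => teqb x y && go xr yr
         | _, _ => false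
         end) xs ys
  end.

Fixpoint subtrees (t : tree) : list tree :=
  match t with
  | Node _ ts =>
      t :: (fix go (ts : list tree) : list tree :=
              match ts with nil => nil | c :: r => subtrees c ++ go r end) ts
  end.

Fixpoint undupt (l : list tree) : list tree :=
  match l with
  | nil => nil
  | x :: r => if existsb (teqb x) r then undupt r else x :: undupt r
  end.

Definition root_arity (t : tree) : nat :=
  match t with Node _ ts => length ts end.

(* Number of edges of the minimal dag: sum over distinct subtrees of the
   number of children of their root. *)
Definition dag_edges (t : tree) : nat :=
  list_sum (map root_arity (undupt (subtrees t))).

Definition avg_dag_edges (m n : nat) : R :=
  fold_right Rplus 0 (map (fun t => INR (dag_edges t)) (trees m n))
  / INR (length (trees m n)).

Definition kappa (m : nat) : R := sqrt (ln (4 * INR m) / PI).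

(* Main.v *)
Require Import Defs.
From Stdlib Require Import Reals List Arith Lia Lra Bool.
Import ListNotations.
Open Scope R_scope.

(** Write q = 4m. The number of trees of size [n] containing a given tree [x]
    depends, to the precision needed here, only on the size p of [x]: with c the
    number of occurrences of [x] in a tree, c - c(c-1)/2 <= [c >= 1] <= min(1, c),
    and the sums of c and of c(c-1)/2 over all trees of size n solve linear
    convolution recurrences, with generating functions built from
    (1 - qz)^(-1/2) and (1 - qz)^(-3/2).

    Cut the sum over p at q^k <= n < q^(k+1), weighting by the root arities, whose
    average over the trees of size p is 3p/(p+2). Below the cut all trees together
    contribute O(n/k^(3/2)), and so do the repeated occurrences above it. The
    first moment above the cut telescopes to 3 n C(2k,k)/4^k up to the same error,
    and Wallis' bounds give C(2k,k)/4^k = (pi k)^(-1/2) (1 + O(1/k)) with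
    k = ln n / ln q + O(1). *)

(** * Finite sums and convolution *)

(** The forest series F satisfies F = 1 + m z F^2, so 1 - 2 m z F = (1 - q z)^(1/2). Occurrences of
    x, or pairs of them, inside the first tree of a forest or inside the rest contribute 2 m z F
    times the unknown series; solving for it divides by that square root, and this is where the
    half-integer powers come from. The cut balances two estimates. There are m q^p [cat p] trees of
    size p, so the small ones are few enough to be bounded by their number alone; the pairs from
    sizes p on carry a factor n^2 q^(-p), which is O(n) only once q^p is comparable to n. At q^k of
    order n both errors keep the factor [cat k] = O(k^(-3/2)). Replacing k by the real number ln n /
    ln q shifts (pi k)^(-1/2) by the same relative order 1/k and produces kappa_m. *)

Definition lsum {A : Type} (f : A -> R) (l : list A) : R :=
  fold_right Rplus 0 (map f l).

Lemma lsum_cons {A} (f : A -> R) x l : lsum f (x :: l) = f x + lsum f l.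
Proof. reflexivity. Qed.

Lemma lsum_app {A} (f : A -> R) l1 l2 : lsum f (l1 ++ l2) = lsum f l1 + lsum f l2.
Proof.
  induction l1 as [|x l1 IH]; simpl; [unfold lsum; simpl; ring|].
  rewrite !lsum_cons, IH; ring.
Qed.

Lemma lsum_map {A B} (f : B -> R) (g : A -> B) l :
  lsum f (map g l) = lsum (fun x => f (g x)) l.
Proof. unfold lsum; now rewrite map_map. Qed.

Lemma lsum_flat_map {A B} (f : B -> R) (g : A -> list B) l :
  lsum f (flat_map g l) = lsum (fun x => lsum f (g x)) l.
Proof.
  induction l as [|x l IH]; [reflexivity|].
  simpl; now rewrite lsum_app, lsum_cons, IH.
Qed.

Lemma lsum_ext {A} (f g : A -> R) l :
  (forall x, In x l -> f x = g x) -> lsum f l = lsum g l.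
Proof. intros H; unfold lsum; f_equal; now apply map_ext_in. Qed.

Lemma lsum_le {A} (f g : A -> R) l :
  (forall x, In x l -> f x <= g x) -> lsum f l <= lsum g l.
Proof.
  induction l as [|x l IH]; intros H; [apply Rle_refl|].
  rewrite !lsum_cons; apply Rplus_le_compat.
  - apply H; now left.
  - apply IH; intros y Hy; apply H; now right.
Qed.

Lemma lsum_plus {A} (f g : A -> R) l :
  lsum (fun x => f x + g x) l = lsum f l + lsum g l.
Proof.
  induction l as [|x l IH]; [unfold lsum; simpl; ring|].
  rewrite !lsum_cons, IH; ring.
Qed.

Lemma lsum_scal {A} (c : R) (f : A -> R) l :
  lsum (fun x => c * f x) l = c * lsum f l.
Proof.
  induction l as [|x l IH]; [unfold lsum; simpl; ring|].
  rewrite !lsum_cons, IH; ring.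
Qed.

Lemma lsum_const {A} (c : R) (l : list A) : lsum (fun _ => c) l = INR (length l) * c.
Proof.
  induction l as [|x l IH]; [unfold lsum; simpl; ring|].
  rewrite lsum_cons, IH; simpl length; rewrite S_INR; ring.
Qed.

Lemma lsum_zero {A} (f : A -> R) l : (forall x, In x l -> f x = 0) -> lsum f l = 0.
Proof.
  intros H; rewrite (lsum_ext f (fun _ => 0)) by assumption.
  rewrite lsum_const; ring.
Qed.

Lemma lsum_swap {A B} (f : A -> B -> R) l1 l2 :
  lsum (fun x => lsum (f x) l2) l1 = lsum (fun y => lsum (fun x => f x y) l1) l2.
Proof.
  induction l1 as [|x l1 IH].
  - symmetry; now apply lsum_zero.
  - rewrite lsum_cons, IH, <- lsum_plus; now apply lsum_ext.
Qed.

Definition conv (a b : nat -> R) (n : nat) : R :=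
  lsum (fun s => a s * b (n - s)%nat) (seq 0 (S n)).

Lemma conv_0 a b : conv a b 0 = a 0%nat * b 0%nat.
Proof. unfold conv, lsum; simpl; ring. Qed.

Lemma conv_S_l a b n :
  conv a b (S n) = a 0%nat * b (S n) + conv (fun i => a (S i)) b n.
Proof.
  unfold conv; rewrite <- (cons_seq (S n) 0), lsum_cons, <- seq_shift, lsum_map.
  f_equal.
Qed.

Lemma conv_S_r a b n :
  conv a b (S n) = conv a (fun i => b (S i)) n + a (S n) * b 0%nat.
Proof.
  unfold conv; rewrite (seq_S (S n)), lsum_app; simpl (0 + S n)%nat.
  f_equal.
  - apply lsum_ext; intros s Hs; apply in_seq in Hs.
    now replace (S n - s)%nat with (S (n - s)) by lia.
  - rewrite lsum_cons, Nat.sub_diag; unfold lsum; simpl; ring.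
Qed.

Lemma conv_ext a b a' b' n :
  (forall i, (i <= n)%nat -> a i = a' i) -> (forall i, (i <= n)%nat -> b i = b' i) ->
  conv a b n = conv a' b' n.
Proof.
  intros Ha Hb; apply lsum_ext; intros s Hs; apply in_seq in Hs.
  rewrite Ha, Hb by lia; reflexivity.
Qed.

Lemma conv_comm a b n : conv a b n = conv b a n.
Proof.
  revert a b; induction n as [|n IH]; intros a b.
  - rewrite !conv_0; ring.
  - rewrite conv_S_l, conv_S_r, IH; ring.
Qed.

Lemma conv_plus_l a a' b n :
  conv (fun i => a i + a' i) b n = conv a b n + conv a' b n.
Proof.
  unfold conv; rewrite <- lsum_plus; apply lsum_ext; intros; ring.
Qed.

Lemma conv_scal_l c a b n : conv (fun i => c * a i) b n = c * conv a b n.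
Proof.
  unfold conv; rewrite <- lsum_scal; apply lsum_ext; intros; ring.
Qed.

Lemma conv_plus_r a b b' n :
  conv a (fun i => b i + b' i) n = conv a b n + conv a b' n.
Proof. now rewrite conv_comm, conv_plus_l, !(conv_comm _ a). Qed.

Lemma conv_scal_r c a b n : conv a (fun i => c * b i) n = c * conv a b n.
Proof. now rewrite conv_comm, conv_scal_l, conv_comm. Qed.

Lemma conv_assoc a b c n : conv (conv a b) c n = conv a (conv b c) n.
Proof.
  revert a; induction n as [|n IH]; intros a.
  - rewrite !conv_0; ring.
  - rewrite conv_S_l, (conv_S_l a), <- IH, conv_0.
    rewrite (conv_ext _ c (fun i => a 0%nat * b (S i) + conv (fun j => a (S j)) b i) c)
      by (intros; rewrite ?conv_S_l; reflexivity).
    rewrite conv_plus_l, conv_scal_l, (conv_S_l b); ring.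
Qed.

Lemma conv_swap a b c n : conv a (conv b c) n = conv b (conv a c) n.
Proof.
  rewrite <- !conv_assoc; apply conv_ext; intros; [apply conv_comm | reflexivity].
Qed.

Lemma conv_geom q a b n :
  conv (fun i => q ^ i * a i) (fun i => q ^ i * b i) n = q ^ n * conv a b n.
Proof.
  unfold conv; rewrite <- lsum_scal; apply lsum_ext; intros s Hs; apply in_seq in Hs.
  replace (q ^ n) with (q ^ s * q ^ (n - s)) by (rewrite <- pow_add; f_equal; lia).
  ring.
Qed.

Definition dl (p n : nat) : R := if Nat.eqb p n then 1 else 0.

Lemma dl_same p : dl p p = 1.
Proof. unfold dl; now rewrite Nat.eqb_refl. Qed.

Lemma dl_neq p n : p <> n -> dl p n = 0.
Proof. unfold dl; intros H; now rewrite (proj2 (Nat.eqb_neq p n) H). Qed.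

Lemma conv_dl p a n : conv (dl p) a n = if Nat.leb p n then a (n - p)%nat else 0.
Proof.
  revert p; induction n as [|n IH]; intros p.
  - rewrite conv_0; destruct p; unfold dl; simpl; ring.
  - rewrite conv_S_l; destruct p as [|p].
    + rewrite dl_same; simpl.
      rewrite (conv_ext _ a (fun i => 0 * dl 0 i) a)
        by (intros; rewrite ?dl_neq by lia; try reflexivity; ring).
      rewrite conv_scal_l; ring.
    + rewrite dl_neq by lia.
      rewrite (conv_ext _ a (dl p) a) by reflexivity.
      rewrite IH; simpl; ring.
Qed.

Lemma conv_dl0 a n : conv (dl 0) a n = a n.
Proof. rewrite conv_dl; simpl; f_equal; lia. Qed.

Lemma conv_dl_dl p r n : conv (dl p) (dl r) n = dl (p + r) n.
Proof.
  rewrite conv_dl; unfold dl.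
  destruct (Nat.leb_spec p n); destruct (Nat.eqb_spec (p + r) n);
    try destruct (Nat.eqb_spec r (n - p)); lia || reflexivity.
Qed.

Lemma lsum_dl p n : (p <= n)%nat -> lsum (dl p) (seq 0 (S n)) = 1.
Proof.
  intros H; transitivity (conv (dl p) (fun _ => 1) n).
  - apply lsum_ext; intros; ring.
  - rewrite conv_dl; now rewrite (proj2 (Nat.leb_le p n) H).
Qed.

(** Plays the part of dividing by the series 1 - r z f: a sum over forests is identified with its
    closed form by checking that both obey one recurrence. *)
Lemma conv_rec_unique (f g y z : nat -> R) (r : R) :
  y 0%nat = z 0%nat ->
  (forall k, y (S k) = g k + r * conv f y k) ->
  (forall k, z (S k) = g k + r * conv f z k) ->
  forall k, y k = z k.
Proof.
  intros H0 Hy Hz k; induction k as [k IH] using lt_wf_ind.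
  destruct k as [|k]; [assumption|].
  rewrite Hy, Hz; do 2 f_equal.
  apply conv_ext; [reflexivity|intros i Hi; apply IH; lia].
Qed.

(** * Normalised central binomial coefficients and Catalan numbers *)

(* [cb k] is [binomial (2k) k / 4^k], and [cat k] is the Catalan number over [4^k]. *)
Fixpoint cb (k : nat) : R :=
  match k with
  | O => 1
  | S k => cb k * ((2 * INR k + 1) / (2 * INR k + 2))
  end.

Definition cat (k : nat) : R := cb k / (INR k + 1).

Lemma cb_S k : cb (S k) = cb k * ((2 * INR k + 1) / (2 * INR k + 2)).
Proof. reflexivity. Qed.

Lemma cb_pos k : 0 < cb k.
Proof.
  induction k as [|k IH]; [simpl; lra|].
  rewrite cb_S; assert (0 <= INR k) by apply pos_INR.
  apply Rmult_lt_0_compat; [assumption|].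
  apply Rdiv_lt_0_compat; lra.
Qed.

Lemma cat_pos k : 0 < cat k.
Proof.
  apply Rdiv_lt_0_compat; [apply cb_pos|].
  assert (0 <= INR k) by apply pos_INR; lra.
Qed.

(* The summand is Gosper-summable in [p], whence the closed form for tails. *)
Lemma cat_cb_tail d k :
  lsum (fun p => cat p * cb (k + d - p)) (seq k (S d))
  = cb k * cb d * (2 * INR d + 1) / (INR k + INR d + 1).
Proof.
  revert k; induction d as [|d IH]; intros k.
  - assert (0 <= INR k) by apply pos_INR.
    simpl seq; rewrite lsum_cons; replace (k + 0 - k)%nat with 0%nat by lia.
    unfold lsum, cat; simpl; field; lra.
  - assert (0 <= INR k) by apply pos_INR; assert (0 <= INR d) by apply pos_INR.
    rewrite <- cons_seq, lsum_cons; replace (k + S d - k)%nat with (S d) by lia.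
    rewrite (lsum_ext _ (fun p => cat p * cb (S k + d - p)))
      by (intros; do 2 f_equal; lia).
    rewrite IH; unfold cat; rewrite !cb_S, !S_INR; field; lra.
Qed.

Lemma conv_cat_cb n : conv cat cb n = 2 * cb (S n).
Proof.
  transitivity (lsum (fun p => cat p * cb (0 + n - p)) (seq 0 (S n))); [reflexivity|].
  rewrite cat_cb_tail, cb_S; simpl (cb 0); simpl (INR 0).
  assert (0 <= INR n) by apply pos_INR; field; lra.
Qed.

Lemma conv_cat_cat n : conv cat cat n = 4 * cat (S n).
Proof.
  assert (Hn : 0 <= INR n) by apply pos_INR.
  (* Since n + 2 = (s + 1) + (n - s + 1), each summand cancels the denominator of one [cat]
     factor. *)
  assert (H : (INR n + 2) * conv cat cat n = conv cb cat n + conv cat cb n).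
  { unfold conv; rewrite <- lsum_scal, <- lsum_plus.
    apply lsum_ext; intros s Hs; apply in_seq in Hs.
    unfold cat; rewrite minus_INR by lia.
    assert (0 <= INR s) by apply pos_INR.
    assert (INR s <= INR n) by (apply le_INR; lia).
    field; lra. }
  rewrite (conv_comm cb cat), conv_cat_cb in H.
  apply (Rmult_eq_reg_l (INR n + 2)); [|lra].
  rewrite H; unfold cat; rewrite (S_INR n); field; lra.
Qed.

(** Symmetrising under s -> n - s replaces the weight by its mean n / 2. *)
Lemma conv_cb_weighted n : 2 * conv (fun i => INR i * cb i) cb n = INR n * conv cb cb n.
Proof.
  transitivity (conv (fun i => INR i * cb i) cb n + conv cb (fun i => INR i * cb i) n).
  - rewrite (conv_comm cb); ring.
  - unfold conv; rewrite <- lsum_plus, <- lsum_scal.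
    apply lsum_ext; intros s Hs; apply in_seq in Hs.
    rewrite minus_INR by lia; ring.
Qed.

(** The square of (1 - z)^(-1/2) is 1 / (1 - z). The induction step passes through the weighted sum,
    where (i + 1) cb (i + 1) = i cb i + cb i / 2, the differential equation of (1 - z)^(-1/2), links
    n + 1 to n. *)
Lemma conv_cb_cb n : conv cb cb n = 1.
Proof.
  induction n as [|n IH]; [rewrite conv_0; simpl; ring|].
  assert (Hn : 0 <= INR n) by apply pos_INR.
  assert (H := conv_cb_weighted (S n)).
  rewrite conv_S_l in H; simpl (INR 0) in H.
  rewrite (conv_ext _ cb (fun i => INR i * cb i + / 2 * cb i) cb) in H.
  2: { intros i _; rewrite cb_S, S_INR; assert (0 <= INR i) by apply pos_INR; field; lra. }
  2: reflexivity.
  rewrite conv_plus_l, conv_scal_l, IH in H.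
  assert (H' := conv_cb_weighted n); rewrite IH in H'.
  apply (Rmult_eq_reg_l (INR (S n))); [|rewrite S_INR; lra].
  rewrite <- H, S_INR; lra.
Qed.

Lemma conv_cat_weighted n :
  conv cat (fun i => 2 * INR i * cb i) n = 4 * (INR n + 1) * cb (S n) - 2.
Proof.
  (* Write n - s = (n + 1) - (s + 1); the second part cancels the denominator of [cat]. *)
  transitivity (2 * (INR n + 1) * conv cat cb n + (-2) * conv cb cb n).
  - unfold conv; rewrite <- !lsum_scal, <- lsum_plus.
    apply lsum_ext; intros s Hs; apply in_seq in Hs.
    unfold cat; rewrite minus_INR by lia.
    assert (0 <= INR s) by apply pos_INR; field; lra.
  - rewrite conv_cat_cb, conv_cb_cb; ring.
Qed.

Lemma Rdiv_le_one x y : 0 < y -> x <= y -> x / y <= 1.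
Proof.
  intros Hy H; apply (Rmult_le_reg_r y); [assumption|].
  unfold Rdiv; rewrite Rmult_assoc, Rinv_l; lra.
Qed.

Lemma cb_antitone k n : (k <= n)%nat -> cb n <= cb k.
Proof.
  induction 1 as [|n _ IH]; [lra|].
  apply Rle_trans with (cb n); [|assumption].
  rewrite cb_S; assert (0 <= INR n) by apply pos_INR; assert (P := cb_pos n).
  assert ((2 * INR n + 1) / (2 * INR n + 2) <= 1) by (apply Rdiv_le_one; lra).
  nra.
Qed.

Lemma cat_S k : cat (S k) = cat k * ((2 * INR k + 1) / (2 * INR k + 4)).
Proof.
  unfold cat; rewrite cb_S, S_INR; assert (0 <= INR k) by apply pos_INR; field; lra.
Qed.

Lemma cat_antitone k n : (k <= n)%nat -> cat n <= cat k.
Proof.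
  induction 1 as [|n _ IH]; [lra|].
  apply Rle_trans with (cat n); [|assumption].
  rewrite cat_S; assert (0 <= INR n) by apply pos_INR; assert (P := cat_pos n).
  assert ((2 * INR n + 1) / (2 * INR n + 4) <= 1) by (apply Rdiv_le_one; lra).
  nra.
Qed.

(** These are the coefficients of (1 - z)^(-3/2), with successive ratios (2n + 3) / (2n + 2). *)
Lemma odd_cb_monotone k n :
  (k <= n)%nat -> (2 * INR k + 1) * cb k <= (2 * INR n + 1) * cb n.
Proof.
  induction 1 as [|n _ IH]; [lra|].
  apply Rle_trans with (1 := IH).
  rewrite cb_S, S_INR; assert (0 <= INR n) by apply pos_INR; assert (P := cb_pos n).
  replace ((2 * (INR n + 1) + 1) * (cb n * ((2 * INR n + 1) / (2 * INR n + 2))))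
    with ((2 * INR n + 1) * cb n * ((2 * INR n + 3) / (2 * INR n + 2))) by (field; lra).
  assert (1 <= (2 * INR n + 3) / (2 * INR n + 2)).
  { apply (Rmult_le_reg_r (2 * INR n + 2)); [lra|].
    replace ((2 * INR n + 3) / (2 * INR n + 2) * (2 * INR n + 2)) with (2 * INR n + 3)
      by (field; lra); lra. }
  assert (0 < (2 * INR n + 1) * cb n) by (apply Rmult_lt_0_compat; lra).
  nra.
Qed.

(** * Wallis' bounds *)

(** The antiderivative of sin^n that vanishes at 0, given by the reduction formula; Wallis'
    integrals are then its values at pi / 2. *)
Fixpoint sin_prim (n : nat) (x : R) : R :=
  match n with
  | O => x
  | 1%nat => - cos x + 1
  | S (S n as n') =>
      / (INR n + 2) * ((INR n + 1) * sin_prim n x - cos x * sin x ^ n')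
  end.

Lemma sin_prim_SS n x :
  sin_prim (S (S n)) x
  = / (INR n + 2) * ((INR n + 1) * sin_prim n x - cos x * sin x ^ S n).
Proof. reflexivity. Qed.

Lemma nat_pair_ind (P : nat -> Prop) :
  P 0%nat -> P 1%nat -> (forall n, P n -> P (S (S n))) -> forall n, P n.
Proof.
  intros H0 H1 HS n; enough (P n /\ P (S n)) by tauto.
  induction n as [|n [IH1 IH2]]; auto.
Qed.

Lemma sin_prim_0 n : sin_prim n 0 = 0.
Proof.
  induction n as [| |n IH] using nat_pair_ind; simpl.
  - reflexivity.
  - rewrite cos_0; ring.
  - rewrite IH, sin_0; ring.
Qed.

Lemma sin_prim_deriv n x : derivable_pt_lim (sin_prim n) x (sin x ^ n).
Proof.
  induction n as [| |n IH] using nat_pair_ind.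
  - apply derivable_pt_lim_id.
  - simpl; replace (sin x * 1) with (- - sin x + 0) by ring.
    apply (derivable_pt_lim_plus (fun x => - cos x) (fun _ => 1)).
    + apply (derivable_pt_lim_opp cos), derivable_pt_lim_cos.
    + apply derivable_pt_lim_const.
  - assert (Hn : 0 <= INR n) by apply pos_INR.
    replace (sin x ^ S (S n)) with
      (/ (INR n + 2) * ((INR n + 1) * sin x ^ n
         - (- sin x * sin x ^ S n + cos x * (INR (S n) * sin x ^ pred (S n) * cos x)))).
    + apply (derivable_pt_lim_scal
               (fun x => (INR n + 1) * sin_prim n x - cos x * sin x ^ S n)).
      apply (derivable_pt_lim_minus (fun x => (INR n + 1) * sin_prim n x)
               (fun x => cos x * sin x ^ S n)).
      * now apply derivable_pt_lim_scal.
      * apply (derivable_pt_lim_mult cos (fun x => sin x ^ S n)).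
        -- apply derivable_pt_lim_cos.
        -- apply (derivable_pt_lim_comp sin (fun y => y ^ S n)).
           ++ apply derivable_pt_lim_sin.
           ++ apply derivable_pt_lim_pow.
    + rewrite S_INR; simpl pred.
      assert (C : cos x * cos x = 1 - sin x * sin x)
        by (generalize (sin2_cos2 x); unfold Rsqr; lra).
      replace (cos x * ((INR n + 1) * sin x ^ n * cos x))
        with ((INR n + 1) * sin x ^ n * (cos x * cos x)) by ring.
      rewrite C; simpl; field; lra.
Qed.

Definition wallis (n : nat) : R := sin_prim n (PI / 2).

(** Mean value theorem on [0, pi/2] for the difference of the two primitives, whose derivative sin^n
    (1 - sin) is nonnegative there. *)
Lemma wallis_antitone n : wallis (S n) <= wallis n.
Proof.
  assert (HP := PI_RGT_0).
  set (g := fun x => sin_prim n x - sin_prim (S n) x).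
  assert (Hd : forall x, derivable_pt_lim g x (sin x ^ n - sin x ^ S n))
    by (intros x; apply derivable_pt_lim_minus; apply sin_prim_deriv).
  destruct (MVT_cor2 g (fun x => sin x ^ n - sin x ^ S n) 0 (PI / 2)) as [c [Hc1 Hc2]];
    [lra | intros; apply Hd |].
  unfold g in Hc1; rewrite !sin_prim_0 in Hc1; unfold wallis.
  assert (0 <= sin c) by (apply sin_ge_0; lra).
  assert (sin c <= 1) by (apply SIN_bound).
  assert (0 <= sin c ^ n) by now apply pow_le.
  assert (0 <= (sin c ^ n - sin c ^ S n) * (PI / 2 - 0)).
  { simpl pow; apply Rmult_le_pos; [nra | lra]. }
  lra.
Qed.

Lemma wallis_SS n : wallis (S (S n)) = (INR n + 1) / (INR n + 2) * wallis n.
Proof.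
  unfold wallis; rewrite sin_prim_SS, cos_PI2.
  assert (0 <= INR n) by apply pos_INR; field; lra.
Qed.

Lemma wallis_even k : wallis (2 * k) = cb k * (PI / 2).
Proof.
  induction k as [|k IH]; [unfold wallis; simpl; field|].
  replace (2 * S k)%nat with (S (S (2 * k))) by lia.
  rewrite wallis_SS, IH, cb_S, mult_INR; simpl (INR 2).
  assert (0 <= INR k) by apply pos_INR; field; lra.
Qed.

Lemma wallis_odd k : wallis (S (2 * k)) * ((2 * INR k + 1) * cb k) = 1.
Proof.
  induction k as [|k IH].
  - unfold wallis; simpl; rewrite cos_PI2; ring.
  - replace (S (2 * S k)) with (S (S (S (2 * k)))) by lia.
    rewrite wallis_SS, cb_S, !S_INR, mult_INR; simpl (INR 2).
    assert (0 <= INR k) by apply pos_INR.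
    etransitivity; [|exact IH]; field; lra.
Qed.

(** Multiplying [wallis (2k+1) <= wallis (2k)] by (2k + 1) cb k gives 1 <= (pi / 2) (2k + 1) (cb
    k)^2. *)
Lemma cb_sqr_ge k : / (PI * (INR k + 1)) <= cb k * cb k.
Proof.
  assert (HP := PI_RGT_0); assert (Hb := cb_pos k).
  assert (Hk : 0 <= INR k) by apply pos_INR.
  assert (H1 := wallis_antitone (2 * k)); rewrite wallis_even in H1.
  assert (H2 := wallis_odd k).
  apply (Rmult_le_reg_l (PI * (INR k + 1))); [nra|].
  rewrite Rinv_r by nra.
  assert (H3 : 0 < (2 * INR k + 1) * cb k) by nra.
  assert (1 <= cb k * (PI / 2) * ((2 * INR k + 1) * cb k)) by nra.
  assert (0 <= cb k * cb k * PI) by nra.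
  nra.
Qed.

(** The next link of the chain, [wallis (2k+2) <= wallis (2k+1)], read at the successor of k. *)
Lemma cb_sqr_le k : (1 <= k)%nat -> cb k * cb k <= / (PI * INR k).
Proof.
  intros Hk1; destruct k as [|k]; [lia|].
  assert (HP := PI_RGT_0); assert (Hb := cb_pos (S k)); assert (Hb' := cb_pos k).
  assert (Hk : 0 <= INR k) by apply pos_INR.
  assert (H1 := wallis_antitone (S (2 * k))).
  replace (S (S (2 * k))) with (2 * S k)%nat in H1 by lia.
  rewrite wallis_even in H1; assert (H2 := wallis_odd k).
  apply (Rmult_le_reg_l (PI * INR (S k))); [rewrite S_INR; nra|].
  rewrite Rinv_r by (rewrite S_INR; nra).
  replace (PI * INR (S k) * (cb (S k) * cb (S k)))
    with (cb (S k) * (PI / 2) * ((2 * INR k + 1) * cb k))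
    by (rewrite (cb_S k); rewrite S_INR; field; lra).
  apply Rle_trans with (2 := Req_le _ _ H2); apply Rmult_le_compat_r; [nra | assumption].
Qed.

(** * Enumeration of trees and forests *)

Lemma tree_nested_ind (P : tree -> Prop) :
  (forall l F, Forall P F -> P (Node l F)) -> forall t, P t.
Proof.
  intros H; fix IH 1; intros [l F]; apply H.
  induction F as [|t F IHF]; constructor; [apply IH | exact IHF].
Qed.

Definition fsize (F : list tree) : nat := list_sum (map (fun t => S (tsize t)) F).

Lemma tsize_Node l F : tsize (Node l F) = fsize F.
Proof.
  unfold fsize; induction F as [|t F IH]; [reflexivity|].
  simpl in *; now rewrite IH.
Qed.

Lemma labels_ok_Node m l F :
  labels_ok m (Node l F) <-> (1 <= l <= m)%nat /\ Forall (labels_ok m) F.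
Proof.
  simpl; apply and_iff_compat_l.
  induction F as [|t F IH]; [split; constructor|].
  rewrite Forall_cons_iff, IH; reflexivity.
Qed.

Lemma subtrees_Node l F : subtrees (Node l F) = Node l F :: flat_map subtrees F.
Proof. reflexivity. Qed.

Lemma teqb_eq s t : teqb s t = true <-> s = t.
Proof.
  revert t; induction s as [a xs IH] using tree_nested_ind; intros [b ys].
  enough (H : forall ys, (fix go (xs ys : list tree) : bool :=
         match xs, ys with
         | nil, nil => true
         | x :: xr, y :: yr => teqb x y && go xr yr
         | _, _ => false
         end) xs ys = true <-> xs = ys).
  { simpl; rewrite andb_true_iff, Nat.eqb_eq, H.
    split; [intros [-> ->]; reflexivity | intros E; now inversion E]. }
  clear a b ys; induction xs as [|x xs IHx]; intros [|y ys]; try (split; easy).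
  apply Forall_cons_iff in IH; destruct IH as [Hx Hxs].
  rewrite andb_true_iff, Hx, (IHx Hxs).
  split; [intros [-> ->]; reflexivity | intros E; now inversion E].
Qed.

Definition tree_eq_dec (s t : tree) : {s = t} + {s <> t}.
Proof.
  destruct (teqb s t) eqn:E.
  - left; now apply teqb_eq.
  - right; intros H; apply teqb_eq in H; congruence.
Defined.

Definition forests (m k : nat) : list (list tree) := forests_f m k k.

Lemma flat_map_ext_in {A B} (f g : A -> list B) l :
  (forall x, In x l -> f x = g x) -> flat_map f l = flat_map g l.
Proof. intros H; rewrite !flat_map_concat_map; f_equal; now apply map_ext_in. Qed.

(** Removing the fuel turns the definition into a true recurrence on the size, which every later
    count uses. *)
Lemma forests_f_fuel m f1 f2 k :
  (k <= f1)%nat -> (k <= f2)%nat -> forests_f m f1 k = forests_f m f2 k.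
Proof.
  revert f2 k; induction f1 as [|f1 IH]; intros [|f2] [|k] H1 H2;
    try reflexivity; try lia.
  change (flat_map (fun s => flat_map (fun t => map (cons t) (forests_f m f1 (k - s)))
              (flat_map (fun l => map (Node l) (forests_f m f1 s)) (seq 1 m))) (seq 0 (S k))
    = flat_map (fun s => flat_map (fun t => map (cons t) (forests_f m f2 (k - s)))
              (flat_map (fun l => map (Node l) (forests_f m f2 s)) (seq 1 m))) (seq 0 (S k))).
  apply flat_map_ext_in; intros s Hs; apply in_seq in Hs.
  rewrite (IH f2 s), (IH f2 (k - s)%nat) by lia; reflexivity.
Qed.

Lemma forests_S m k :
  forests m (S k)
  = flat_map (fun s => flat_map (fun t => map (cons t) (forests m (k - s))) (trees m s))
      (seq 0 (S k)).
Proof.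
  change (forests m (S k)) with
    (flat_map (fun s => flat_map (fun t => map (cons t) (forests_f m k (k - s)))
              (flat_map (fun l => map (Node l) (forests_f m k s)) (seq 1 m))) (seq 0 (S k))).
  apply flat_map_ext_in; intros s Hs; apply in_seq in Hs.
  unfold trees, forests.
  rewrite (forests_f_fuel m k s s), (forests_f_fuel m k (k - s) (k - s)) by lia.
  reflexivity.
Qed.

Lemma lsum_forests_0 m phi : lsum phi (forests m 0) = phi nil.
Proof. unfold lsum; simpl; ring. Qed.

Lemma lsum_forests_S m phi k :
  lsum phi (forests m (S k))
  = lsum (fun s => lsum (fun t => lsum (fun F => phi (t :: F)) (forests m (k - s)))
                     (trees m s)) (seq 0 (S k)).
Proof.
  rewrite forests_S, lsum_flat_map; apply lsum_ext; intros s _.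
  rewrite lsum_flat_map; apply lsum_ext; intros t _; apply lsum_map.
Qed.

Lemma lsum_trees m phi n :
  lsum phi (trees m n)
  = lsum (fun l => lsum (fun F => phi (Node l F)) (forests m n)) (seq 1 m).
Proof.
  unfold trees; rewrite lsum_flat_map; apply lsum_ext; intros l _; apply lsum_map.
Qed.

Lemma in_trees m n t :
  In t (trees m n) <->
  exists l F, t = Node l F /\ (1 <= l <= m)%nat /\ In F (forests m n).
Proof.
  unfold trees; rewrite in_flat_map; split.
  - intros (l & Hl & H); apply in_map_iff in H; destruct H as (F & <- & HF).
    apply in_seq in Hl; exists l, F; repeat split; auto; lia.
  - intros (l & F & -> & Hl & HF); exists l; split; [apply in_seq; lia|].
    now apply in_map.
Qed.

Lemma forests_sound m k F :
  In F (forests m k) -> Forall (labels_ok m) F /\ fsize F = k.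
Proof.
  revert F; induction k as [k IH] using lt_wf_ind; intros F HF.
  destruct k as [|k].
  - destruct HF as [<-|[]]; split; [constructor|reflexivity].
  - rewrite forests_S in HF; apply in_flat_map in HF; destruct HF as (s & Hs & HF).
    apply in_seq in Hs.
    apply in_flat_map in HF; destruct HF as (t & Ht & HF).
    apply in_map_iff in HF; destruct HF as (F' & <- & HF').
    apply in_trees in Ht; destruct Ht as (l & F0 & -> & Hl & HF0).
    apply IH in HF'; [|lia]; apply IH in HF0; [|lia].
    split.
    + constructor; [|tauto]; apply labels_ok_Node; tauto.
    + change (S (tsize (Node l F0)) + fsize F' = S k)%nat.
      rewrite tsize_Node; lia.
Qed.

Lemma trees_sound m n t : In t (trees m n) -> labels_ok m t /\ tsize t = n.
Proof.
  intros H; apply in_trees in H; destruct H as (l & F & -> & Hl & HF).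
  apply forests_sound in HF; rewrite tsize_Node, labels_ok_Node; tauto.
Qed.

Lemma subtrees_tsize t s : In s (subtrees t) -> (tsize s <= tsize t)%nat.
Proof.
  revert s; induction t as [l F IH] using tree_nested_ind; intros s.
  rewrite subtrees_Node; intros [<-|H]; [lia|].
  rewrite tsize_Node; apply in_flat_map in H; destruct H as (t & Ht & Hs).
  induction IH as [|u F Hu HF IHF]; [easy|].
  change (fsize (u :: F)) with (S (tsize u) + fsize F)%nat.
  destruct Ht as [->|Ht]; [apply Hu in Hs | specialize (IHF Ht)]; lia.
Qed.

Lemma fsubtrees_tsize F s : In s (flat_map subtrees F) -> (tsize s < fsize F)%nat.
Proof.
  induction F as [|t F IH]; [easy|].
  change (fsize (t :: F)) with (S (tsize t) + fsize F)%nat.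
  simpl; rewrite in_app_iff; intros [H|H]; [apply subtrees_tsize in H | apply IH in H]; lia.
Qed.

Lemma subtrees_labels_ok m t s : labels_ok m t -> In s (subtrees t) -> labels_ok m s.
Proof.
  revert s; induction t as [l F IH] using tree_nested_ind; intros s Ht.
  rewrite subtrees_Node; intros [<-|H]; [assumption|].
  apply labels_ok_Node in Ht; destruct Ht as [_ Ht].
  apply in_flat_map in H; destruct H as (t & HF & Hs).
  rewrite Forall_forall in IH, Ht; eauto.
Qed.

Definition delta (s t : tree) : R := if tree_eq_dec s t then 1 else 0.

Definition fdelta (F G : list tree) : R :=
  if list_eq_dec tree_eq_dec F G then 1 else 0.

Lemma delta_Node l F l' F' : delta (Node l F) (Node l' F') = dl l l' * fdelta F F'.
Proof.
  unfold delta, fdelta, dl.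
  destruct (tree_eq_dec _ _) as [E|E]; destruct (list_eq_dec _ _ _) as [E'|E'];
    destruct (Nat.eqb_spec l l'); try ring; exfalso; congruence.
Qed.

Lemma fdelta_cons t F t' F' : fdelta (t :: F) (t' :: F') = delta t t' * fdelta F F'.
Proof.
  unfold delta, fdelta.
  destruct (list_eq_dec _ _ _) as [E|E]; destruct (list_eq_dec _ _ _) as [E'|E'];
    destruct (tree_eq_dec t t'); try ring; exfalso; congruence.
Qed.

Lemma delta_sym s t : delta s t = delta t s.
Proof.
  unfold delta; destruct (tree_eq_dec s t), (tree_eq_dec t s); congruence.
Qed.

Lemma lsum_dl_seq1 l m : (1 <= l <= m)%nat -> lsum (dl l) (seq 1 m) = 1.
Proof.
  intros H; assert (E := lsum_dl l m ltac:(lia)).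
  rewrite <- cons_seq, lsum_cons, dl_neq in E by lia; lra.
Qed.

(** The sum counts how often x is listed, so this is completeness and absence of duplicates in one
    equation. *)
Lemma lsum_delta_trees m x n :
  labels_ok m x -> lsum (delta x) (trees m n) = dl (tsize x) n.
Proof.
  revert n; induction x as [l F IH] using tree_nested_ind; intros n Hx.
  apply labels_ok_Node in Hx; destruct Hx as [Hl HF].
  enough (HFk : forall k, lsum (fdelta F) (forests m k) = dl (fsize F) k).
  { rewrite lsum_trees, tsize_Node, <- HFk.
    rewrite (lsum_ext _ (fun l' => lsum (fdelta F) (forests m n) * dl l l')).
    - rewrite lsum_scal, lsum_dl_seq1 by assumption; ring.
    - intros l' _; rewrite Rmult_comm, <- lsum_scal.
      apply lsum_ext; intros; apply delta_Node. }
  clear n l Hl; induction IH as [|t F Ht _ IHF]; intros [|k].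
  - rewrite lsum_forests_0; reflexivity.
  - rewrite lsum_forests_S; change (dl (fsize []) (S k)) with 0.
    repeat (apply lsum_zero; intros ? _); reflexivity.
  - rewrite lsum_forests_0; reflexivity.
  - inversion_clear HF as [|? ? Hlt HlF].
    rewrite lsum_forests_S.
    (* The indicator of a forest factors over head and tail, so two unit masses are convolved into
       one at the total size. *)
    transitivity (conv (dl (tsize t)) (dl (fsize F)) k).
    + apply lsum_ext; intros s _.
      rewrite <- (Ht s Hlt), <- (IHF HlF), Rmult_comm, <- lsum_scal.
      apply lsum_ext; intros t' _; rewrite Rmult_comm, <- lsum_scal.
      apply lsum_ext; intros; apply fdelta_cons.
    + rewrite conv_dl_dl; reflexivity.
Qed.

(** * Counting occurrences of a fixed subtree *)

Lemma lsum2_mult {A B} (f : A -> R) (g : B -> R) l1 l2 :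
  lsum (fun x => lsum (fun y => f x * g y) l2) l1 = lsum f l1 * lsum g l2.
Proof.
  rewrite Rmult_comm, <- lsum_scal; apply lsum_ext; intros.
  rewrite lsum_scal; ring.
Qed.

Lemma lsum2_plus {A B} (f : A -> R) (g : B -> R) l1 l2 :
  lsum (fun x => lsum (fun y => f x + g y) l2) l1
  = lsum f l1 * lsum (fun _ => 1) l2 + lsum (fun _ => 1) l1 * lsum g l2.
Proof.
  rewrite <- !lsum2_mult, <- lsum_plus; apply lsum_ext; intros.
  rewrite <- lsum_plus; apply lsum_ext; intros; ring.
Qed.

Lemma lsum_trees_children m (phi : tree -> R) (g : list tree -> R) n :
  (forall l F, phi (Node l F) = g F) ->
  lsum phi (trees m n) = INR m * lsum g (forests m n).
Proof.
  intros H; rewrite lsum_trees.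
  rewrite (lsum_ext _ (fun _ => lsum g (forests m n)))
    by (intros; apply lsum_ext; intros; apply H).
  now rewrite lsum_const, length_seq.
Qed.

Definition fcount (m k : nat) : R := lsum (fun _ => 1) (forests m k).

Lemma tree_count m n : lsum (fun _ => 1) (trees m n) = INR m * fcount m n.
Proof. now apply lsum_trees_children. Qed.

Lemma fcount_S m k : fcount m (S k) = INR m * conv (fcount m) (fcount m) k.
Proof.
  unfold fcount at 1; rewrite lsum_forests_S; unfold conv; rewrite <- lsum_scal.
  apply lsum_ext; intros s _.
  rewrite <- Rmult_assoc, <- tree_count; unfold fcount; rewrite <- lsum2_mult.
  do 2 (apply lsum_ext; intros); ring.
Qed.

Lemma fcount_cat m k : fcount m k = (4 * INR m) ^ k * cat k.
Proof.
  induction k as [k IH] using lt_wf_ind; destruct k as [|k].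
  - unfold fcount; rewrite lsum_forests_0; unfold cat; simpl; field.
  - rewrite fcount_S.
    rewrite (conv_ext _ _ (fun i => (4 * INR m) ^ i * cat i)
                          (fun i => (4 * INR m) ^ i * cat i)) by (intros; apply IH; lia).
    rewrite conv_geom, conv_cat_cat; simpl; ring.
Qed.

Lemma fcount_pos m k : (1 <= m)%nat -> 0 < fcount m k.
Proof.
  intros Hm; rewrite fcount_cat; apply Rmult_lt_0_compat; [|apply cat_pos].
  apply pow_lt; apply le_INR in Hm; simpl in Hm; lra.
Qed.

(** A forest has length + 1 gaps, and cutting it at a gap gives an ordered pair of forests; hence
    length + 1 sums to the convolution of [fcount m] with itself, which is [fcount m (S k) / INR m].
    The proof checks this through a common recurrence. *)
Lemma length_sum m k :
  (1 <= m)%nat ->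
  lsum (fun F => INR (length F)) (forests m k) = fcount m (S k) / INR m - fcount m k.
Proof.
  intros Hm; assert (Hm' : 0 < INR m) by (apply lt_0_INR; lia).
  set (len := fun k => lsum (fun F => INR (length F)) (forests m k)).
  assert (Hlen : forall k, len (S k)
     = INR m * (conv (fcount m) (fcount m) k + conv (fcount m) len k)).
  { intros j; unfold len at 1; rewrite lsum_forests_S.
    unfold conv; rewrite <- lsum_plus, <- lsum_scal; apply lsum_ext; intros s _.
    transitivity (INR m * fcount m s * (lsum (fun F => 1 + INR (length F)) (forests m (j - s)))).
    - rewrite <- tree_count, <- lsum2_mult; do 2 (apply lsum_ext; intros).
      simpl length; rewrite S_INR; ring.
    - rewrite lsum_plus; unfold len, fcount; ring. }
  enough (H : forall k, fcount m k + len k = fcount m (S k) / INR m)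
    by (rewrite <- H; unfold len; ring).
  apply (conv_rec_unique (fcount m) (fun k => fcount m (S k)) _ _ (INR m)).
  - rewrite fcount_S, conv_0; unfold len, fcount; rewrite !lsum_forests_0; simpl; field; lra.
  - intros j; rewrite Hlen, conv_plus_r; ring.
  - intros j; rewrite fcount_S, conv_S_r.
    replace (fcount m 0) with 1 by (unfold fcount; rewrite lsum_forests_0; reflexivity).
    rewrite (conv_ext (fcount m) (fun i => fcount m (S i) / INR m)
               (fcount m) (fun i => / INR m * fcount m (S i)))
      by (intros; unfold Rdiv; ring).
    rewrite conv_scal_r; field; lra.
Qed.

(** By the ratio of consecutive Catalan numbers the mean arity is 4 (2p + 1) / (2p + 4) - 1; its
    limit is the 3 of the theorem. *)
Lemma root_arity_sum m p :
  (1 <= m)%nat ->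
  lsum (fun x => INR (root_arity x)) (trees m p)
  = INR m * (4 * INR m) ^ p * cat p * (3 * INR p / (INR p + 2)).
Proof.
  intros Hm; assert (Hm' : 0 < INR m) by (apply lt_0_INR; lia).
  rewrite (lsum_trees_children m _ (fun F => INR (length F))) by reflexivity.
  rewrite length_sum, !fcount_cat, cat_S by assumption.
  assert (0 <= INR p) by apply pos_INR; simpl; field; lra.
Qed.

Definition occ (x t : tree) : R := lsum (delta x) (subtrees t).
Definition focc (x : tree) (F : list tree) : R := lsum (delta x) (flat_map subtrees F).

Lemma occ_Node x l F : occ x (Node l F) = delta x (Node l F) + focc x F.
Proof. reflexivity. Qed.

Lemma focc_cons x t F : focc x (t :: F) = occ x t + focc x F.
Proof. unfold focc, occ; simpl; now rewrite lsum_app. Qed.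

Lemma focc_large x F : (fsize F <= tsize x)%nat -> focc x F = 0.
Proof.
  intros H; apply lsum_zero; intros y Hy; apply fsubtrees_tsize in Hy.
  unfold delta; destruct (tree_eq_dec x y) as [->|]; [lia | reflexivity].
Qed.

Definition pairs (c : R) : R := c * (c - 1) / 2.

Lemma pairs_plus c d : pairs (c + d) = pairs c + pairs d + c * d.
Proof. unfold pairs; field. Qed.

(** If the whole tree is x, then by size x does not occur below the root, so the root never belongs
    to a pair. *)
Lemma pairs_occ_Node x l F : pairs (occ x (Node l F)) = pairs (focc x F).
Proof.
  rewrite occ_Node; unfold delta; destruct (tree_eq_dec x (Node l F)) as [->|].
  - rewrite focc_large by (rewrite tsize_Node; lia); unfold pairs; field.
  - f_equal; ring.
Qed.

Lemma occ_trees_sum m x n :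
  labels_ok m x ->
  lsum (occ x) (trees m n) = dl (tsize x) n + INR m * lsum (focc x) (forests m n).
Proof.
  intros Hx; rewrite <- (lsum_delta_trees m x n Hx).
  rewrite <- (lsum_trees_children m (fun t => occ x t - delta x t))
    by (intros; rewrite occ_Node; ring).
  rewrite <- lsum_plus; apply lsum_ext; intros; ring.
Qed.

(* Coefficients of [((1 - 4 m z)^(-1/2) - 1) / (2 m)]. *)
Definition occ_kernel (m j : nat) : R := / (2 * INR m) * ((4 * INR m) ^ j * cb j + (-1) * dl 0 j).

(** In series form K = z F + 2 m z F K. *)
Lemma occ_kernel_S m k :
  (1 <= m)%nat ->
  occ_kernel m (S k) = fcount m k + 2 * INR m * conv (fcount m) (occ_kernel m) k.
Proof.
  intros Hm; assert (Hm' : 0 < INR m) by (apply lt_0_INR; lia).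
  unfold occ_kernel; rewrite conv_scal_r, conv_plus_r, conv_scal_r.
  rewrite (conv_comm _ (dl 0)), conv_dl0.
  rewrite (conv_ext (fcount m) _ (fun i => (4 * INR m) ^ i * cat i)
             (fun i => (4 * INR m) ^ i * cb i)) by (intros; rewrite ?fcount_cat; reflexivity).
  rewrite conv_geom, conv_cat_cb, (dl_neq 0) by lia.
  simpl pow; field; lra.
Qed.

(** An occurrence is the root of the first tree, lies below that root, or lies in the remaining
    forest. The first case is the source term of the recurrence, the other two give its coefficient
    2 m F. *)
Lemma focc_sum m x k :
  (1 <= m)%nat -> labels_ok m x ->
  lsum (focc x) (forests m k) = conv (dl (tsize x)) (occ_kernel m) k.
Proof.
  intros Hm Hx; assert (Hm' : 0 < INR m) by (apply lt_0_INR; lia).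
  assert (Hh0 : occ_kernel m 0 = 0).
  { unfold occ_kernel; rewrite dl_same; simpl; ring. }
  revert k; apply (conv_rec_unique (fcount m) (conv (dl (tsize x)) (fcount m)) _ _ (2 * INR m)).
  - rewrite lsum_forests_0, conv_0, Hh0; unfold focc, lsum; simpl; ring.
  - intros k; rewrite lsum_forests_S.
    transitivity (conv (fun s => dl (tsize x) s + INR m * lsum (focc x) (forests m s)) (fcount m) k
                  + conv (fcount m) (fun s => INR m * lsum (focc x) (forests m s)) k).
    + unfold conv; rewrite <- lsum_plus; apply lsum_ext; intros s _.
      rewrite <- occ_trees_sum by assumption.
      transitivity (lsum (occ x) (trees m s) * fcount m (k - s)
        + INR m * fcount m s * lsum (focc x) (forests m (k - s))); [|ring].
      rewrite <- tree_count; unfold fcount; rewrite <- lsum2_plus.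
      do 2 (apply lsum_ext; intros); apply focc_cons.
    + rewrite conv_plus_l, conv_scal_l, conv_scal_r.
      rewrite (conv_comm (fun i => lsum (focc x) (forests m i))); ring.
  - intros k; rewrite conv_S_r, Hh0.
    rewrite (conv_ext (dl (tsize x)) _ (dl (tsize x))
               (fun i => fcount m i + 2 * INR m * conv (fcount m) (occ_kernel m) i))
      by (intros; rewrite ?occ_kernel_S by assumption; reflexivity).
    rewrite conv_plus_r, conv_scal_r, conv_swap; ring.
Qed.

(* Coefficients of [z^2 (1 - 4 m z)^(-3/2)]. *)
Definition pair_kernel (m j : nat) : R :=
  match j with
  | O => 0
  | S k => (4 * INR m) ^ k * (2 * INR k * cb k) / (4 * INR m)
  end.

(** With B = (1 - 4 m z)^(-1/2) this is (B + 1) / 2 times (B - 1) / (2 m), and B^2 is geometric. *)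
Lemma occ_kernel_square m k :
  (1 <= m)%nat ->
  conv (fun i => dl 0 i + INR m * occ_kernel m i) (occ_kernel m) k
  = / (4 * INR m) * ((4 * INR m) ^ k - dl 0 k).
Proof.
  intros Hm; assert (Hm' : 0 < INR m) by (apply lt_0_INR; lia).
  set (B := fun i => (4 * INR m) ^ i * cb i).
  assert (HB : conv B B k = (4 * INR m) ^ k)
    by (unfold B; rewrite conv_geom, conv_cb_cb; ring).
  rewrite (conv_ext _ _ (fun i => / 2 * (B i + dl 0 i))
             (fun i => / (2 * INR m) * (B i + (-1) * dl 0 i)))
    by (intros; unfold occ_kernel, B; try reflexivity; field; lra).
  rewrite conv_scal_l, conv_scal_r, conv_plus_l, !conv_plus_r, !conv_scal_r, !conv_dl0.
  rewrite (conv_comm B (dl 0)), conv_dl0, HB; field; lra.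
Qed.

Lemma pair_kernel_S m k :
  (1 <= m)%nat ->
  pair_kernel m (S k)
  = conv (fun i => dl 0 i + INR m * occ_kernel m i) (occ_kernel m) k
    + 2 * INR m * conv (fcount m) (pair_kernel m) k.
Proof.
  intros Hm; assert (Hm' : 0 < INR m) by (apply lt_0_INR; lia).
  rewrite occ_kernel_square by assumption; destruct k as [|k].
  - rewrite conv_0, dl_same; simpl; field; lra.
  - rewrite conv_S_r, dl_neq by lia; simpl (pair_kernel m 0).
    rewrite (conv_ext (fcount m) _ (fun i => (4 * INR m) ^ i * cat i)
             (fun i => / (4 * INR m) * ((4 * INR m) ^ i * (2 * INR i * cb i))))
      by (intros; rewrite ?fcount_cat; simpl; unfold Rdiv; ring).
    rewrite conv_scal_r, conv_geom, conv_cat_weighted.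
    unfold pair_kernel; rewrite S_INR; simpl pow; field; lra.
Qed.

(** Two occurrences lie both in the first tree, both in the remaining forest, or one in each; the
    split pairs are the source term. *)
Lemma pairs_focc_sum m x k :
  (1 <= m)%nat -> labels_ok m x ->
  lsum (fun F => pairs (focc x F)) (forests m k)
  = conv (dl (tsize x)) (conv (dl (tsize x)) (pair_kernel m)) k.
Proof.
  intros Hm Hx; set (p := tsize x).
  set (h1 := fun i => dl 0 i + INR m * occ_kernel m i).
  revert k; apply (conv_rec_unique (fcount m)
     (conv (dl p) (conv (dl p) (conv h1 (occ_kernel m)))) _ _ (2 * INR m)).
  - rewrite lsum_forests_0, !conv_0; unfold focc, lsum, pairs; simpl; field.
  - intros k; rewrite lsum_forests_S.
    set (P := fun s => lsum (fun F => pairs (focc x F)) (forests m s)).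
    set (M := fun s => lsum (focc x) (forests m s)).
    transitivity (conv (fun s => INR m * P s) (fcount m) k + conv (fcount m) (fun s => INR m * P s) k
       + conv (fun s => dl p s + INR m * M s) M k).
    + unfold conv; rewrite <- !lsum_plus; apply lsum_ext; intros s _.
      unfold M at 1; unfold p; rewrite <- occ_trees_sum by assumption.
      unfold P at 1; rewrite <- (lsum_trees_children m (fun t => pairs (occ x t)))
        by (intros; apply pairs_occ_Node).
      transitivity (lsum (fun t => pairs (occ x t)) (trees m s) * fcount m (k - s)
        + INR m * fcount m s * P (k - s)%nat + lsum (occ x) (trees m s) * M (k - s)%nat);
        [|ring].
      rewrite <- tree_count; unfold fcount, P, M.
      rewrite <- lsum2_plus, <- lsum2_mult, <- lsum_plus; apply lsum_ext; intros.
      rewrite <- lsum_plus; apply lsum_ext; intros.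
      now rewrite focc_cons, pairs_plus.
    + rewrite conv_scal_l, conv_scal_r, (conv_comm P).
      (* Each factor of the split term carries a shift by p, so the source is shifted by 2p. *)
      rewrite (conv_ext (fun s => dl p s + INR m * M s) M (conv (dl p) h1)
                 (conv (dl p) (occ_kernel m))).
      * rewrite conv_assoc, (conv_ext (dl p) _ (dl p)
           (conv (dl p) (conv h1 (occ_kernel m)))) by (intros; auto using conv_swap).
        ring.
      * intros i _; unfold h1, M.
        rewrite focc_sum, conv_plus_r, conv_scal_r, (conv_comm _ (dl 0)), conv_dl0
          by assumption; reflexivity.
      * intros i _; now apply focc_sum.
  - assert (HK : forall a k, conv a (pair_kernel m) (S k)
       = conv a (fun i => pair_kernel m (S i)) k) by (intros; rewrite conv_S_r; simpl; ring).
    intros k; rewrite conv_S_r, conv_0; simpl (pair_kernel m 0).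
    rewrite (conv_ext (dl p) _ (dl p) (fun i => conv (dl p) (conv h1 (occ_kernel m)) i
        + 2 * INR m * conv (fcount m) (conv (dl p) (pair_kernel m)) i)).
    + rewrite conv_plus_r, conv_scal_r, (conv_swap (dl p) (fcount m)); ring.
    + reflexivity.
    + intros i _; rewrite HK, (conv_ext (dl p) _ (dl p)
        (fun i => conv h1 (occ_kernel m) i + 2 * INR m * conv (fcount m) (pair_kernel m) i))
        by (intros; unfold h1; rewrite <- ?pair_kernel_S by assumption; reflexivity).
      rewrite conv_plus_r, conv_scal_r, (conv_swap (dl p) (fcount m)); reflexivity.
Qed.

(** * The average number of dag edges as a sum over subtrees *)

Definition present (x t : tree) : R :=
  if in_dec tree_eq_dec x (subtrees t) then 1 else 0.

Lemma lsum_delta_count x l : lsum (delta x) l = INR (count_occ tree_eq_dec l x).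
Proof.
  induction l as [|y l IH]; [reflexivity|].
  rewrite lsum_cons, IH, delta_sym; unfold delta; simpl.
  destruct (tree_eq_dec y x); [rewrite S_INR|]; ring.
Qed.

Lemma present_le_1 x t : present x t <= 1.
Proof. unfold present; destruct in_dec; lra. Qed.

Lemma present_le_occ x t : present x t <= occ x t.
Proof.
  unfold present, occ; rewrite lsum_delta_count.
  destruct in_dec as [H|H]; [|apply pos_INR].
  apply (count_occ_In tree_eq_dec) in H; apply (le_INR 1); lia.
Qed.

Lemma present_bonferroni x t : occ x t - pairs (occ x t) <= present x t.
Proof.
  unfold present, occ, pairs; rewrite lsum_delta_count.
  destruct in_dec as [H|H].
  - apply (count_occ_In tree_eq_dec) in H.
    destruct (count_occ tree_eq_dec (subtrees t) x) as [|[|c]]; [lia | simpl; lra |].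
    rewrite !S_INR; assert (0 <= INR c) by apply pos_INR; nra.
  - apply (count_occ_not_In tree_eq_dec) in H; rewrite H; simpl; lra.
Qed.

Lemma existsb_teqb x l : existsb (teqb x) l = true <-> In x l.
Proof.
  rewrite existsb_exists; split.
  - intros (y & Hy & E); apply teqb_eq in E; now subst.
  - intros H; exists x; split; [assumption | now apply teqb_eq].
Qed.

Lemma in_undupt x l : In x (undupt l) <-> In x l.
Proof.
  induction l as [|y l IH]; [reflexivity|]; simpl.
  destruct (existsb (teqb y) l) eqn:E.
  - apply existsb_teqb in E; rewrite IH; split; [tauto | intros [->|]; auto].
  - simpl; tauto.
Qed.

Lemma NoDup_undupt l : NoDup (undupt l).
Proof.
  induction l as [|y l IH]; [constructor|]; simpl.
  destruct (existsb (teqb y) l) eqn:E; [assumption|].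
  constructor; [|assumption].
  rewrite in_undupt, <- existsb_teqb; congruence.
Qed.

Lemma lsum_delta_undupt x t : lsum (delta x) (undupt (subtrees t)) = present x t.
Proof.
  rewrite lsum_delta_count; unfold present; destruct in_dec as [H|H].
  - apply in_undupt in H.
    rewrite (proj1 (NoDup_count_occ' tree_eq_dec _) (NoDup_undupt _) x H); reflexivity.
  - rewrite <- in_undupt in H; apply (count_occ_not_In tree_eq_dec) in H.
    now rewrite H.
Qed.

Lemma INR_list_sum {A} (f : A -> nat) l :
  INR (list_sum (map f l)) = lsum (fun x => INR (f x)) l.
Proof.
  induction l as [|x l IH]; [reflexivity|].
  rewrite lsum_cons, <- IH; simpl; apply plus_INR.
Qed.

(** Every distinct subtree of t has valid labels and size at most n, so it is listed exactly once
    among the trees of sizes 0 to n. The index set no longer depends on t, which lets the average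
    move inside. *)
Lemma dag_edges_sum m n t :
  In t (trees m n) ->
  INR (dag_edges t)
  = lsum (fun p => lsum (fun x => INR (root_arity x) * present x t) (trees m p))
      (seq 0 (S n)).
Proof.
  intros Ht; apply trees_sound in Ht; destruct Ht as [Hl Hn].
  unfold dag_edges; rewrite INR_list_sum; symmetry.
  rewrite (lsum_ext _ (fun p => lsum (fun y => INR (root_arity y) * dl (tsize y) p)
                                  (undupt (subtrees t)))).
  - rewrite lsum_swap; apply lsum_ext; intros y Hy.
    apply (proj1 (in_undupt _ _)), subtrees_tsize in Hy.
    rewrite lsum_scal, lsum_dl by lia; ring.
  - intros p _.
    rewrite (lsum_ext _ (fun x => lsum (fun y => INR (root_arity y) * delta y x)
                                    (undupt (subtrees t)))).
    + rewrite lsum_swap; apply lsum_ext; intros y Hy.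
      apply (proj1 (in_undupt _ _)) in Hy.
      rewrite lsum_scal, lsum_delta_trees; [reflexivity|].
      eauto using subtrees_labels_ok.
    + intros x _; rewrite <- lsum_delta_undupt, <- lsum_scal.
      apply lsum_ext; intros y _; rewrite (delta_sym x y).
      unfold delta; destruct (tree_eq_dec y x) as [->|]; ring.
Qed.

Definition containing (m n : nat) (x : tree) : R := lsum (present x) (trees m n).

Lemma avg_dag_edges_sum m n :
  avg_dag_edges m n
  = / (INR m * fcount m n)
    * lsum (fun p => lsum (fun x => INR (root_arity x) * containing m n x) (trees m p))
        (seq 0 (S n)).
Proof.
  unfold avg_dag_edges, Rdiv; fold (lsum (fun t => INR (dag_edges t)) (trees m n)).
  rewrite <- tree_count, lsum_const, Rmult_1_r, Rmult_comm; f_equal.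
  rewrite (lsum_ext _ _ _ (dag_edges_sum m n)), lsum_swap.
  apply lsum_ext; intros p _; rewrite lsum_swap.
  apply lsum_ext; intros x _; apply lsum_scal.
Qed.

Lemma containing_le_all m n x : containing m n x <= INR m * fcount m n.
Proof.
  rewrite <- tree_count; apply lsum_le; intros; apply present_le_1.
Qed.

(** At p = n the root adds 1 and the constant term subtracted in [occ_kernel] takes back 1/2, which
    leaves half a unit mass. *)
Lemma occ_trees_sum_closed m n x p :
  (1 <= m)%nat -> In x (trees m p) -> (p <= n)%nat ->
  lsum (occ x) (trees m n) = ((4 * INR m) ^ (n - p) * cb (n - p) + dl p n) / 2.
Proof.
  intros Hm Hx Hpn; assert (Hm' : 0 < INR m) by (apply lt_0_INR; lia).
  apply trees_sound in Hx; destruct Hx as [Hx Hp].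
  rewrite occ_trees_sum, focc_sum, conv_dl, Hp, (proj2 (Nat.leb_le p n)) by assumption.
  unfold occ_kernel.
  replace (dl 0 (n - p)) with (dl p n); [field; lra|].
  unfold dl; destruct (Nat.eqb_spec p n), (Nat.eqb_spec 0 (n - p)); lia || reflexivity.
Qed.

Lemma containing_le m n x p :
  (1 <= m)%nat -> In x (trees m p) -> (p <= n)%nat ->
  containing m n x <= ((4 * INR m) ^ (n - p) * cb (n - p) + dl p n) / 2.
Proof.
  intros Hm Hx Hpn; rewrite <- (occ_trees_sum_closed m n x p) by assumption.
  apply lsum_le; intros; apply present_le_occ.
Qed.

(** Freezing the subexponential factor at n makes the later bound purely geometric in p. *)
Lemma pair_kernel_le m j n :
  (1 <= m)%nat -> (j <= n)%nat ->
  pair_kernel m j <= (4 * INR m) ^ j * ((2 * INR n + 1) * cb n).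
Proof.
  intros Hm Hj; assert (Hm' : 1 <= INR m) by (apply (le_INR 1); lia).
  assert (Hn := cb_pos n); assert (0 <= INR n) by apply pos_INR.
  destruct j as [|k]; simpl pair_kernel.
  - simpl; assert (0 <= (2 * INR n + 1) * cb n) by nra; lra.
  - assert (H1 := odd_cb_monotone k n ltac:(lia)); assert (H2 := cb_pos k).
    assert (Hq : 0 < (4 * INR m) ^ k) by (apply pow_lt; lra).
    set (Q := (4 * INR m) ^ k) in *.
    assert (0 <= INR k) by apply pos_INR.
    assert (0 <= 2 * INR k * cb k) by nra.
    apply Rle_trans with (Q * (2 * INR k * cb k)).
    + apply (Rmult_le_reg_r (4 * INR m)); [lra|].
      unfold Rdiv; rewrite Rmult_assoc, Rinv_l by lra.
      assert (0 <= Q * (2 * INR k * cb k)) by nra; nra.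
    + simpl pow; fold Q.
      apply Rle_trans with (Q * ((2 * INR n + 1) * cb n)); [apply Rmult_le_compat_l; nra|].
      assert (0 <= Q * ((2 * INR n + 1) * cb n)) by nra; nra.
Qed.

Lemma containing_ge m n x p :
  (1 <= m)%nat -> In x (trees m p) -> (p <= n)%nat ->
  (4 * INR m) ^ (n - p) * cb (n - p) / 2
  - INR m * ((4 * INR m) ^ n * ((2 * INR n + 1) * cb n) / ((4 * INR m) ^ p) ^ 2)
  <= containing m n x.
Proof.
  intros Hm Hx Hpn; assert (Hm' : 1 <= INR m) by (apply (le_INR 1); lia).
  assert (E := occ_trees_sum_closed m n x p Hm Hx Hpn).
  assert (Hdl : 0 <= dl p n) by (unfold dl; destruct Nat.eqb; lra).
  assert (HP : lsum (fun t => pairs (occ x t)) (trees m n)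
     <= INR m * ((4 * INR m) ^ n * ((2 * INR n + 1) * cb n) / ((4 * INR m) ^ p) ^ 2)).
  { rewrite (lsum_trees_children m _ (fun F => pairs (focc x F)))
      by (intros; apply pairs_occ_Node).
    apply Rmult_le_compat_l; [lra|].
    apply trees_sound in Hx; destruct Hx as [Hx Hp].
    rewrite pairs_focc_sum, conv_dl, Hp, (proj2 (Nat.leb_le p n)), conv_dl by assumption.
    assert (Hq : 0 < (4 * INR m) ^ p) by (apply pow_lt; lra).
    assert (Hq' : 0 < (4 * INR m) ^ n) by (apply pow_lt; lra).
    assert (Hn := cb_pos n); assert (0 <= INR n) by apply pos_INR.
    assert (0 < (2 * INR n + 1) * cb n) by nra.
    (* For 2p > n two copies of x do not fit and the pair sum is 0; the bound then holds because it
       is nonnegative. *)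
    destruct (Nat.leb_spec p (n - p)).
    - replace ((4 * INR m) ^ n * ((2 * INR n + 1) * cb n) / ((4 * INR m) ^ p) ^ 2)
        with ((4 * INR m) ^ (n - p - p) * ((2 * INR n + 1) * cb n)).
      + apply pair_kernel_le; [assumption | lia].
      + replace n with ((n - p - p) + (p + p))%nat at 4 by lia.
        rewrite !pow_add; field; lra.
    - apply Rlt_le, Rdiv_lt_0_compat; [nra|]; apply pow_lt; lra. }
  apply Rle_trans with (lsum (fun t => occ x t + (-1) * pairs (occ x t)) (trees m n)).
  - rewrite lsum_plus, lsum_scal, E; lra.
  - apply lsum_le; intros t _; assert (B := present_bonferroni x t); lra.
Qed.

(** * Explicit bounds for a given cut-off size [k] *)

Definition aritysum (m p : nat) : R := lsum (fun x => INR (root_arity x)) (trees m p).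

Lemma aritysum_le m p :
  (1 <= m)%nat -> 0 <= aritysum m p <= 3 * INR m * ((4 * INR m) ^ p * cat p).
Proof.
  intros Hm; unfold aritysum; rewrite root_arity_sum by assumption.
  assert (Hm' : 1 <= INR m) by (apply (le_INR 1); lia).
  assert (Hq : 0 < (4 * INR m) ^ p) by (apply pow_lt; lra).
  assert (Hc := cat_pos p); assert (Hp : 0 <= INR p) by apply pos_INR.
  set (v := INR p / (INR p + 2)).
  assert (0 <= v <= 1).
  { unfold v; split; [|apply Rdiv_le_one; lra].
    apply Rmult_le_pos; [lra | apply Rlt_le, Rinv_0_lt_compat; lra]. }
  replace (INR m * (4 * INR m) ^ p * cat p * (3 * INR p / (INR p + 2)))
    with (3 * INR m * ((4 * INR m) ^ p * cat p) * v) by (unfold v; field; lra).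
  assert (0 < (4 * INR m) ^ p * cat p) by nra.
  assert (0 < 3 * INR m * ((4 * INR m) ^ p * cat p)) by nra.
  nra.
Qed.

Lemma lsum_trees_arity_le m p (w : tree -> R) (u : R) :
  (forall x, In x (trees m p) -> w x <= u) ->
  lsum (fun x => INR (root_arity x) * w x) (trees m p) <= aritysum m p * u.
Proof.
  intros H; rewrite Rmult_comm; unfold aritysum; rewrite <- lsum_scal; apply lsum_le.
  intros x Hx; rewrite (Rmult_comm u); apply Rmult_le_compat_l; [apply pos_INR | auto].
Qed.

Lemma lsum_trees_arity_ge m p (w : tree -> R) (u : R) :
  (forall x, In x (trees m p) -> u <= w x) ->
  aritysum m p * u <= lsum (fun x => INR (root_arity x) * w x) (trees m p).
Proof.
  intros H; rewrite Rmult_comm; unfold aritysum; rewrite <- lsum_scal; apply lsum_le.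
  intros x Hx; rewrite (Rmult_comm u); apply Rmult_le_compat_l; [apply pos_INR | auto].
Qed.

(** From index 1 on, terms grow at least by the factor q / 2 >= 2, so each partial sum stays below
    the next term; the base case is 1 <= q / 4. *)
Lemma lsum_geom_cat q k :
  4 <= q -> (1 <= k)%nat -> lsum (fun p => q ^ p * cat p) (seq 0 k) <= q ^ k * cat k.
Proof.
  intros Hq; induction 1 as [|k Hk IH].
  - unfold lsum, cat; simpl; lra.
  - rewrite seq_S, lsum_app, lsum_cons; simpl (0 + k)%nat.
    change (lsum (fun p => q ^ p * cat p) []) with 0.
    rewrite cat_S; simpl pow.
    assert (H1 : 1 <= INR k) by (apply (le_INR 1); lia).
    assert (0 < q ^ k * cat k)
      by (apply Rmult_lt_0_compat; [apply pow_lt; lra | apply cat_pos]).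
    assert (/ 2 <= (2 * INR k + 1) / (2 * INR k + 4)).
    { apply (Rmult_le_reg_r (2 * INR k + 4)); [lra|].
      unfold Rdiv; rewrite Rmult_assoc, Rinv_l; lra. }
    set (r := (2 * INR k + 1) / (2 * INR k + 4)) in *.
    assert (2 <= q * r) by nra.
    replace (q * q ^ k * (cat k * r)) with (q ^ k * cat k * (q * r)) by ring.
    nra.
Qed.

Lemma lsum_geom_tail r k d :
  0 <= r <= / 2 -> lsum (fun p => r ^ p) (seq k d) <= 2 * r ^ k.
Proof.
  intros Hr; revert k; induction d as [|d IH]; intros k.
  - assert (0 <= r ^ k) by (apply pow_le; lra); unfold lsum; simpl; lra.
  - simpl seq; rewrite lsum_cons; assert (H := IH (S k)); simpl pow in H.
    assert (0 <= r ^ k) by (apply pow_le; lra); nra.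
Qed.

(* The expected number of subtree occurrences with at least [k] edges, up to [O(1)]. *)
Definition large_occ (k d : nat) : R := cb k * (cb d * (2 * INR d + 1) / (2 * cb (k + d))).

Lemma large_occ_sum k d :
  / (2 * cat (k + d)) * lsum (fun p => cat p * cb (k + d - p)) (seq k (S d)) = large_occ k d.
Proof.
  rewrite cat_cb_tail; unfold large_occ, cat; rewrite plus_INR.
  assert (H := cb_pos (k + d)).
  assert (0 <= INR k) by apply pos_INR; assert (0 <= INR d) by apply pos_INR.
  field; lra.
Qed.

(** Below the cut each tree is charged its arity as if it occurred everywhere; above it, occurrences
    are counted with multiplicity. The constant 3 pays for the unit mass at p = n in
    [containing_le]. *)
Lemma avg_dag_edges_le m k d :
  (1 <= m)%nat -> (1 <= k)%nat ->
  avg_dag_edges m (k + d)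
  <= 3 * INR m * ((4 * INR m) ^ k * cat k) + 3 * large_occ k d + 3.
Proof.
  intros Hm Hk; assert (Hm' : 1 <= INR m) by (apply (le_INR 1); lia).
  set (n := (k + d)%nat); set (q := 4 * INR m).
  assert (HT := fcount_pos m n Hm).
  assert (HT' : 0 < INR m * fcount m n) by nra.
  rewrite avg_dag_edges_sum.
  replace (S n) with (k + S d)%nat by (unfold n; lia).
  rewrite seq_app, lsum_app, Nat.add_0_l, Rmult_plus_distr_l, Rplus_assoc.
  apply Rplus_le_compat.
  - apply Rle_trans with (3 * INR m * lsum (fun p => q ^ p * cat p) (seq 0 k)).
    + rewrite <- !lsum_scal; apply lsum_le; intros p _.
      apply Rle_trans with (aritysum m p); [|now apply aritysum_le].
      apply (Rmult_le_reg_l (INR m * fcount m n)); [assumption|].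
      rewrite <- Rmult_assoc, Rinv_r, Rmult_1_l, (Rmult_comm _ (aritysum m p)) by lra.
      apply lsum_trees_arity_le; intros; apply containing_le_all.
    + apply Rmult_le_compat_l; [lra|]; apply lsum_geom_cat; [unfold q; lra | assumption].
  - rewrite <- large_occ_sum, <- !lsum_scal; fold n.
    apply Rle_trans with (lsum (fun p => 3 * (/ (2 * cat n) * (cat p * cb (n - p))) + 3 * dl n p)
                            (seq k (S d))).
    + apply lsum_le; intros p Hp; apply in_seq in Hp.
      apply (Rmult_le_reg_l (INR m * fcount m n)); [assumption|].
      rewrite <- Rmult_assoc, Rinv_r, Rmult_1_l by lra.
      eapply Rle_trans.
      * apply lsum_trees_arity_le; intros x Hx.
        apply (containing_le m n x p); [assumption | assumption | unfold n; lia].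
      * destruct (aritysum_le m p Hm) as [Ha0 Ha]; fold q in Ha |- *.
        assert (Hq : 0 < q ^ p) by (apply pow_lt; unfold q; lra).
        assert (Hq' : 0 < q ^ (n - p)) by (apply pow_lt; unfold q; lra).
        assert (Hb := cb_pos (n - p)); assert (Hcn := cat_pos n).
        assert (Hdl : 0 <= dl p n) by (unfold dl; destruct Nat.eqb; lra).
        eapply Rle_trans.
        { apply Rmult_le_compat_r; [|exact Ha].
          assert (0 < q ^ (n - p) * cb (n - p)) by nra; lra. }
        rewrite fcount_cat; fold q.
        assert (Hs : dl p n * (q ^ p * cat p) = dl n p * (q ^ n * cat n)).
        { unfold dl; rewrite (Nat.eqb_sym n p); destruct (Nat.eqb_spec p n) as [->|]; ring. }
        replace (q ^ n) with (q ^ p * q ^ (n - p)) in Hs |- *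
          by (rewrite <- pow_add; f_equal; unfold n; lia).
        assert (Hdl' : 0 <= dl n p * (q ^ p * q ^ (n - p) * cat n)).
        { apply Rmult_le_pos; [unfold dl; destruct Nat.eqb; lra|].
          assert (0 < q ^ p * q ^ (n - p)) by nra; nra. }
        apply Rminus_le.
        replace (3 * INR m * (q ^ p * cat p) * ((q ^ (n - p) * cb (n - p) + dl p n) / 2)
          - INR m * (q ^ p * q ^ (n - p) * cat n)
            * (3 * (/ (2 * cat n) * (cat p * cb (n - p))) + 3 * dl n p))
        with (3 / 2 * INR m * (dl p n * (q ^ p * cat p))
              - 3 * INR m * (dl n p * (q ^ p * q ^ (n - p) * cat n))) by (field; lra).
        rewrite Hs; nra.
    + rewrite lsum_plus, !lsum_scal; apply Rplus_le_compat_l.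
      assert (E := lsum_dl n n (le_n n)).
      replace (S n) with (k + S d)%nat in E by (unfold n; lia).
      rewrite seq_app, lsum_app, Nat.add_0_l in E.
      assert (0 <= lsum (dl n) (seq 0 k)).
      { rewrite <- (lsum_zero (fun _ => 0) (seq 0 k)) by reflexivity.
        apply lsum_le; intros; unfold dl; destruct Nat.eqb; lra. }
      lra.
Qed.

(** Sizes below k are dropped, the mean arity 3 - 6 / (p + 2) is bounded below by its value at k,
    and the pair terms form a geometric tail. *)
Lemma avg_dag_edges_ge m k d :
  (1 <= m)%nat ->
  (3 - 6 / (INR k + 2)) * large_occ k d
  - 6 * INR m * ((2 * INR (k + d) + 1) * (INR (k + d) + 1) * cat k / (4 * INR m) ^ k)
  <= avg_dag_edges m (k + d).
Proof.
  intros Hm; assert (Hm' : 1 <= INR m) by (apply (le_INR 1); lia).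
  set (n := (k + d)%nat); set (q := 4 * INR m).
  assert (Hk : 0 <= INR k) by apply pos_INR.
  assert (Hn : 0 <= INR n) by apply pos_INR.
  assert (Hcn := cat_pos n); assert (Hck := cat_pos k).
  assert (HT := fcount_pos m n Hm).
  assert (HT' : 0 < INR m * fcount m n) by nra.
  (* Arity sum times pair bound over the number of trees: cb n / cat n = n + 1, and q^p / q^(2p)
     leaves the factor q^(-p). *)
  set (c := 3 * INR m * ((2 * INR n + 1) * (INR n + 1)) * cat k).
  assert (Hc : 0 <= c).
  { unfold c; apply Rmult_le_pos; [|lra]; apply Rmult_le_pos; nra. }
  apply Rle_trans with
    (lsum (fun p => (3 - 6 / (INR k + 2)) * (/ (2 * cat n) * (cat p * cb (n - p)))
                    + (- c) * (/ q) ^ p) (seq k (S d))).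
  - rewrite lsum_plus, !lsum_scal; unfold n at 3 4; rewrite large_occ_sum.
    apply Rplus_le_compat_l.
    assert (G := lsum_geom_tail (/ q) k (S d)).
    assert (Hq : 0 <= / q <= / 2).
    { split; [apply Rlt_le, Rinv_0_lt_compat; unfold q; lra|].
      apply Rinv_le_contravar; unfold q; lra. }
    specialize (G Hq).
    replace (- (6 * INR m * ((2 * INR n + 1) * (INR n + 1) * cat k / q ^ k)))
      with (- (c * (2 * (/ q) ^ k))).
    + rewrite <- Ropp_mult_distr_l; apply Ropp_le_contravar, Rmult_le_compat_l; assumption.
    + rewrite pow_inv; unfold c; field; apply pow_nonzero; unfold q; lra.
  - rewrite avg_dag_edges_sum.
    replace (S n) with (k + S d)%nat by (unfold n; lia).
    rewrite seq_app, lsum_app, Nat.add_0_l.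
    assert (Hc0 : forall x, 0 <= containing m n x).
    { intros x; rewrite <- (lsum_zero (fun _ => 0) (trees m n)) by reflexivity.
      apply lsum_le; intros; unfold present; destruct in_dec; lra. }
    assert (H0 : 0 <= lsum (fun p => lsum (fun x => INR (root_arity x) * containing m n x)
                       (trees m p)) (seq 0 k)).
    { rewrite <- (lsum_zero (fun _ => 0) (seq 0 k)) by reflexivity.
      apply lsum_le; intros p _.
      rewrite <- (lsum_zero (fun _ => 0) (trees m p)) by reflexivity.
      apply lsum_le; intros x _; apply Rmult_le_pos; [apply pos_INR | apply Hc0]. }
    rewrite Rmult_plus_distr_l.
    apply Rle_trans with (2 := Rplus_le_compat_r _ _ _
       (Rmult_le_pos _ _ (Rlt_le _ _ (Rinv_0_lt_compat _ HT')) H0)).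
    rewrite Rplus_0_l, <- lsum_scal; apply lsum_le; intros p Hp; apply in_seq in Hp.
    apply (Rmult_le_reg_l (INR m * fcount m n)); [assumption|].
    rewrite <- Rmult_assoc with (r3 := lsum _ _), Rinv_r, Rmult_1_l by lra.
    eapply Rle_trans; [|apply lsum_trees_arity_ge; intros x Hx;
      apply (containing_ge m n x p); [assumption | assumption | unfold n; lia]].
    fold q; rewrite Rmult_minus_distr_l.
    assert (Hq : 0 < q ^ p) by (apply pow_lt; unfold q; lra).
    assert (Hq' : 0 < q ^ (n - p)) by (apply pow_lt; unfold q; lra).
    assert (Hb := cb_pos (n - p)); assert (Hbn := cb_pos n); assert (Hcp := cat_pos p).
    assert (Eq : q ^ n = q ^ p * q ^ (n - p))
      by (rewrite <- pow_add; f_equal; unfold n; lia).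
    rewrite Rmult_plus_distr_l; apply Rplus_le_compat.
    + unfold aritysum; rewrite root_arity_sum, fcount_cat by assumption; fold q; rewrite Eq.
      assert (Hpk : INR k <= INR p) by (apply le_INR; lia).
      replace (INR m * (q ^ p * q ^ (n - p) * cat n)
                * ((3 - 6 / (INR k + 2)) * (/ (2 * cat n) * (cat p * cb (n - p)))))
        with (INR m * q ^ p * cat p * (q ^ (n - p) * cb (n - p) / 2) * (3 - 6 / (INR k + 2)))
        by (field; lra).
      replace (INR m * q ^ p * cat p * (3 * INR p / (INR p + 2)) * (q ^ (n - p) * cb (n - p) / 2))
        with (INR m * q ^ p * cat p * (q ^ (n - p) * cb (n - p) / 2) * (3 - 6 / (INR p + 2)))
        by (field; lra).
      apply Rmult_le_compat_l.
      * assert (0 < INR m * q ^ p) by nra.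
        assert (0 < q ^ (n - p) * cb (n - p)) by nra.
        apply Rmult_le_pos; nra.
      * assert (/ (INR p + 2) <= / (INR k + 2)) by (apply Rinv_le_contravar; lra).
        unfold Rdiv; lra.
    + destruct (aritysum_le m p Hm) as [Ha0 Ha]; fold q in Ha.
      assert (Hcpk : cat p <= cat k) by (apply cat_antitone; lia).
      rewrite <- Ropp_mult_distr_l, <- Ropp_mult_distr_r; apply Ropp_le_contravar.
      apply Rle_trans with (3 * INR m * (q ^ p * cat k)
          * (INR m * (q ^ n * ((2 * INR n + 1) * cb n) / (q ^ p) ^ 2))).
      * apply Rmult_le_compat_r.
        -- rewrite Eq; apply Rmult_le_pos; [lra|].
           apply Rmult_le_pos.
           ++ assert (0 < q ^ p * q ^ (n - p)) by nra.
              apply Rmult_le_pos; nra.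
           ++ apply Rlt_le, Rinv_0_lt_compat, pow_lt; lra.
        -- apply Rle_trans with (1 := Ha); apply Rmult_le_compat_l; [lra|].
           apply Rmult_le_compat_l; lra.
      * rewrite fcount_cat; fold q; unfold c, cat at 2; rewrite pow_inv.
        right; field; split; lra.
Qed.

(** * Asymptotics *)

Lemma cb_bounds k :
  (1 <= k)%nat -> sqrt (/ (PI * (INR k + 1))) <= cb k <= sqrt (/ (PI * INR k)).
Proof.
  intros Hk; rewrite <- (sqrt_square (cb k)) by (apply Rlt_le, cb_pos).
  split; apply sqrt_le_1_alt; [apply cb_sqr_ge | now apply cb_sqr_le].
Qed.

Lemma cb_le_inv_sqrt k : (1 <= k)%nat -> cb k <= / sqrt (INR k).
Proof.
  intros Hk; assert (Hk' : 1 <= INR k) by (apply (le_INR 1); lia).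
  assert (HP := PI2_1).
  apply Rle_trans with (1 := proj2 (cb_bounds k Hk)).
  rewrite <- sqrt_inv; apply sqrt_le_1_alt, Rinv_le_contravar; nra.
Qed.

(** Both values lie between the two Wallis bounds u <= v, and v^2 - u^2 = v^2 / (k + 1) forces v - u
    <= v / k. Later L is ln n / ln q. *)
Lemma cb_approx k L :
  (1 <= k)%nat -> INR k <= L <= INR k + 1 ->
  Rabs (cb k - sqrt (/ (PI * L))) <= / (INR k * sqrt (INR k)).
Proof.
  intros Hk HL; assert (Hk' : 1 <= INR k) by (apply (le_INR 1); lia).
  assert (HP := PI2_1).
  set (u := sqrt (/ (PI * (INR k + 1)))); set (v := sqrt (/ (PI * INR k))).
  assert (Hb : u <= cb k <= v) by now apply cb_bounds.
  assert (Hw : u <= sqrt (/ (PI * L)) <= v).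
  { split; apply sqrt_le_1_alt, Rinv_le_contravar; nra. }
  assert (Hu : u * u = / (PI * (INR k + 1)))
    by (apply sqrt_sqrt, Rlt_le, Rinv_0_lt_compat; nra).
  assert (Hv : v * v = / (PI * INR k))
    by (apply sqrt_sqrt, Rlt_le, Rinv_0_lt_compat; nra).
  assert (Hv0 : 0 < v) by (apply sqrt_lt_R0, Rinv_0_lt_compat; nra).
  assert (Hu0 : 0 <= u) by apply sqrt_pos.
  assert (Hvs : v <= / sqrt (INR k)).
  { rewrite <- sqrt_inv; apply sqrt_le_1_alt, Rinv_le_contravar; nra. }
  assert (Huv : (v - u) * INR k <= v).
  { apply (Rmult_le_reg_r v); [assumption|].
    assert (E : (v * v - u * u) * (INR k + 1) = v * v) by (rewrite Hu, Hv; field; lra).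
    assert (0 <= v * v - u * u) by nra.
    assert ((v - u) * v <= v * v - u * u) by nra.
    nra. }
  apply Rle_trans with (v - u); [apply Rabs_le; lra|].
  assert (Hs : 0 < sqrt (INR k)) by (apply sqrt_lt_R0; lra).
  apply (Rmult_le_reg_r (INR k)); [lra|].
  replace (/ (INR k * sqrt (INR k)) * INR k) with (/ sqrt (INR k)) by (field; lra).
  lra.
Qed.

(** The two monotonicity lemmas show that this factor is k + d up to an error of at most max(k,
    1). *)
Lemma large_occ_factor k d :
  INR d <= cb d * (2 * INR d + 1) / (2 * cb (k + d)) <= INR (k + d) + 1.
Proof.
  assert (H1 := cb_antitone d (k + d) ltac:(lia)).
  assert (H2 := odd_cb_monotone d (k + d) ltac:(lia)).
  assert (H3 := cb_pos (k + d)); assert (0 <= INR d) by apply pos_INR.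
  split; apply (Rmult_le_reg_r (2 * cb (k + d))); try lra;
    (replace (cb d * (2 * INR d + 1) / (2 * cb (k + d)) * (2 * cb (k + d)))
       with (cb d * (2 * INR d + 1)) by (field; lra)); nra.
Qed.

Lemma large_occ_approx k d L :
  (1 <= k)%nat -> INR k <= L <= INR k + 1 ->
  Rabs (large_occ k d - INR (k + d) * sqrt (/ (PI * L)))
  <= INR k + INR (k + d) / (INR k * sqrt (INR k)).
Proof.
  intros Hk HL; assert (Hk' : 1 <= INR k) by (apply (le_INR 1); lia).
  assert (F := large_occ_factor k d); unfold large_occ.
  set (r := cb d * (2 * INR d + 1) / (2 * cb (k + d))) in *.
  replace (cb k * r - INR (k + d) * sqrt (/ (PI * L)))
    with (cb k * (r - INR (k + d)) + INR (k + d) * (cb k - sqrt (/ (PI * L)))) by ring.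
  apply Rle_trans with (1 := Rabs_triang _ _); apply Rplus_le_compat.
  - rewrite Rabs_mult, (Rabs_pos_eq (cb k)) by (apply Rlt_le, cb_pos).
    assert (cb k <= 1) by (apply (cb_antitone 0 k); lia).
    assert (H0 := cb_pos k).
    assert (Rabs (r - INR (k + d)) <= INR k).
    { apply Rabs_le; rewrite plus_INR in *; lra. }
    assert (0 <= Rabs (r - INR (k + d))) by apply Rabs_pos.
    nra.
  - rewrite Rabs_mult, (Rabs_pos_eq (INR (k + d))) by apply pos_INR.
    apply Rmult_le_compat_l; [apply pos_INR | now apply cb_approx].
Qed.

(** Yields k^3 <= n, by which additive errors O(k) are absorbed into n / k^(3/2). *)
Lemma cube_le_pow4 k : (k * k * k <= 4 ^ k)%nat.
Proof.
  destruct k as [|[|[|k]]]; [simpl; lia | simpl; lia | simpl; lia|].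
  induction k as [|k IH]; [simpl; lia|].
  change (4 ^ S (S (S (S k))))%nat with (4 * 4 ^ S (S (S k)))%nat.
  nia.
Qed.

(** With e = n / k^(3/2), the upper bound costs at most (9 + 3m) e and the lower one (18 + 144 m^2)
    e; the constant exceeds both. *)
Lemma avg_dag_edges_approx m n k L :
  (1 <= m)%nat -> (1 <= k)%nat -> ((4 * m) ^ k <= n < (4 * m) ^ S k)%nat ->
  INR k <= L <= INR k + 1 ->
  Rabs (avg_dag_edges m n - 3 * (INR n * sqrt (/ (PI * L))))
  <= (21 + 3 * INR m + 144 * INR m * INR m) * (INR n / (INR k * sqrt (INR k))).
Proof.
  intros Hm Hk [Hn1 Hn2] HL.
  assert (Hm' : 1 <= INR m) by (apply (le_INR 1); lia).
  assert (Hk' : 1 <= INR k) by (apply (le_INR 1); lia).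
  assert (Hs1 : 1 <= sqrt (INR k)) by (rewrite <- sqrt_1; now apply sqrt_le_1_alt).
  assert (Hss : sqrt (INR k) * sqrt (INR k) = INR k) by (apply sqrt_sqrt; lra).
  assert (Hkn : INR k * INR k * INR k <= INR n).
  { rewrite <- !mult_INR; apply le_INR.
    apply Nat.le_trans with (1 := cube_le_pow4 k), Nat.le_trans with (2 := Hn1).
    apply Nat.pow_le_mono_l; lia. }
  assert (Hnk : (k <= n)%nat) by (apply INR_le; nra).
  assert (Hq1 : (4 * INR m) ^ k <= INR n).
  { replace (4 * INR m) with (INR (4 * m)) by (rewrite mult_INR; simpl; lra).
    rewrite <- pow_INR; now apply le_INR. }
  assert (Hq2 : INR n <= 4 * INR m * (4 * INR m) ^ k).
  { change (4 * INR m * (4 * INR m) ^ k) with ((4 * INR m) ^ S k).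
    replace (4 * INR m) with (INR (4 * m)) by (rewrite mult_INR; simpl; lra).
    rewrite <- pow_INR; apply le_INR; lia. }
  clear Hn1 Hn2.
  replace n with (k + (n - k))%nat in Hkn, Hq1, Hq2 |- * by lia.
  set (d := (n - k)%nat) in *; clearbody d; clear n Hnk.
  set (N := INR (k + d)) in *; set (s := sqrt (INR k)) in *; set (Q := (4 * INR m) ^ k) in *.
  assert (HQ : 0 < Q) by (apply pow_lt; lra).
  set (e := N / (INR k * s)).
  assert (Hks : 0 < INR k * s) by nra.
  assert (HN : 1 <= N) by nra.
  assert (He : e * (INR k * s) = N) by (unfold e; field; nra).
  assert (Hke : INR k <= e).
  { apply (Rmult_le_reg_r (INR k * s)); [assumption|]; rewrite He.
    assert (s <= INR k) by nra.
    assert (INR k * (INR k * s) <= INR k * INR k * INR k) by nra; lra. }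
  assert (Hcat : N * cat k <= e).
  { unfold cat, e; unfold Rdiv; apply Rmult_le_compat_l; [lra|].
    rewrite Rinv_mult, Rmult_comm; assert (Hb := cb_le_inv_sqrt k Hk); assert (Hb' := cb_pos k).
    apply Rmult_le_compat; [apply Rlt_le, Rinv_0_lt_compat; lra | lra | | assumption].
    apply Rinv_le_contravar; lra. }
  assert (Hcp := cat_pos k).
  assert (Happ := large_occ_approx k d L Hk HL); fold N s e in Happ.
  assert (Hup := avg_dag_edges_le m k d Hm Hk); fold Q in Hup.
  assert (Hlo := avg_dag_edges_ge m k d Hm); fold N Q in Hlo.
  set (w := N * sqrt (/ (PI * L))) in *; set (M := large_occ k d) in *.
  assert (Hw1 := Rle_abs (M - w)); assert (Hw2 := Rle_abs (- (M - w))).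
  rewrite Rabs_Ropp in Hw2.
  (* The two sides of the cut are used separately: Q <= N here, N <= 4 m Q in [HE]. *)
  assert (HQc : Q * cat k <= e) by nra.
  (* The loss from the mean arity falling short of 3: M = cat k (k + 1) r with r <= N + 1 <= 2 N,
     and N cat k <= e. *)
  assert (HM : 6 / (INR k + 2) * M <= 12 * e).
  { assert (F := large_occ_factor k d); unfold M, large_occ.
    set (r := cb d * (2 * INR d + 1) / (2 * cb (k + d))) in *; fold N in F.
    assert (HNc : cb k = cat k * (INR k + 1)) by (unfold cat; field; lra).
    rewrite HNc.
    replace (6 / (INR k + 2) * (cat k * (INR k + 1) * r))
      with (6 * (cat k * r) * ((INR k + 1) / (INR k + 2))) by (field; lra).
    assert (0 <= INR d) by apply pos_INR.
    assert (0 <= (INR k + 1) / (INR k + 2) <= 1).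
    { split; [apply Rlt_le, Rdiv_lt_0_compat; lra | apply Rdiv_le_one; lra]. }
    assert (0 <= cat k * r <= 2 * e) by nra.
    nra. }
  assert (HE : (2 * N + 1) * (N + 1) * cat k / Q <= 24 * INR m * e).
  { apply (Rmult_le_reg_r Q); [assumption|].
    unfold Rdiv; rewrite Rmult_assoc, Rinv_l, Rmult_1_r by lra.
    assert (H1 : (2 * N + 1) * (N + 1) <= 6 * N * N) by nra.
    apply Rle_trans with (6 * N * (N * cat k)); [nra|].
    assert (0 <= N * cat k) by nra.
    apply Rle_trans with (6 * N * e); [nra|].
    assert (0 <= e) by lra.
    nra. }
  apply Rabs_le; split.
  - assert (INR m * ((2 * N + 1) * (N + 1) * cat k / Q) <= INR m * (24 * INR m * e))
      by (apply Rmult_le_compat_l; lra).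
    assert (0 <= INR m * e) by nra.
    lra.
  - assert (INR m * (Q * cat k) <= INR m * e) by (apply Rmult_le_compat_l; lra).
    assert (0 <= INR m * (INR m * e)) by (assert (0 <= INR m * e) by nra; nra).
    lra.
Qed.

Lemma log_bracket b n :
  (2 <= b)%nat -> (1 <= n)%nat -> exists k, (b ^ k <= n < b ^ S k)%nat.
Proof.
  intros Hb; induction 1 as [|n Hn [k IH]].
  - exists 0%nat; simpl; lia.
  - destruct (Nat.lt_ge_cases (S n) (b ^ S k)) as [H|H].
    + exists k; lia.
    + exists (S k); split; [assumption|].
      simpl in *; nia.
Qed.

Lemma ln_monotone x y : 0 < x -> x <= y -> ln x <= ln y.
Proof.
  intros Hx [H | ->]; [|apply Rle_refl].
  now apply Rlt_le, ln_increasing.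
Qed.

(* E(n) = 3 kappa_m n / sqrt(ln n) * (1 + O(1/ln n)) as n -> oo *)
Theorem theorem10 (m : nat) (hm : (1 <= m)%nat) :
  exists (C : R) (N : nat), forall n : nat, (N <= n)%nat ->
    Rabs (avg_dag_edges m n - 3 * kappa m * INR n / sqrt (ln (INR n)))
      <= C * (INR n / sqrt (ln (INR n))) / ln (INR n).
Proof.
  set (c0 := 21 + 3 * INR m + 144 * INR m * INR m).
  set (lq := ln (4 * INR m)).
  (* From n >= 4m on, k >= 1, so ln n <= (k + 1) lq <= 2 k lq. This turns k^(-3/2) into (ln
     n)^(-3/2) at a cost of 2^(3/2), rounded up to 4. *)
  exists (c0 * (4 * (lq * sqrt lq))), (4 * m)%nat; intros n Hn.
  assert (Hm : 1 <= INR m) by (apply (le_INR 1); lia).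
  assert (Hc0 : 0 <= c0) by (unfold c0; nra).
  assert (Hq : INR (4 * m) = 4 * INR m) by (rewrite mult_INR; simpl; lra).
  assert (HnR : 4 * INR m <= INR n) by (rewrite <- Hq; now apply le_INR).
  assert (Hlq : 0 < lq) by (unfold lq; rewrite <- ln_1; apply ln_increasing; lra).
  destruct (log_bracket (4 * m) n) as [k Hk]; [lia | lia |].
  assert (Hk1 : (1 <= k)%nat).
  { destruct k; [simpl in Hk; lia | lia]. }
  assert (Hk1' : 1 <= INR k) by (apply (le_INR 1); lia).
  set (ln_n := ln (INR n)).
  assert (Hkl : INR k * lq <= ln_n).
  { unfold lq, ln_n; rewrite <- ln_pow by lra.
    apply ln_monotone; [apply pow_lt; lra|].
    rewrite <- Hq, <- pow_INR; apply le_INR; lia. }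
  assert (Hkl' : ln_n <= (INR k + 1) * lq).
  { rewrite <- S_INR; unfold lq, ln_n; rewrite <- ln_pow by lra.
    apply ln_monotone; [lra|].
    rewrite <- Hq, <- pow_INR; apply le_INR; lia. }
  assert (Hln : 0 < ln_n) by nra.
  assert (HP := PI_RGT_0).
  assert (HL : INR k <= ln_n / lq <= INR k + 1).
  { split; apply (Rmult_le_reg_r lq); try assumption;
      unfold Rdiv; rewrite Rmult_assoc, Rinv_l; lra. }
  assert (H := avg_dag_edges_approx m n k (ln_n / lq) hm Hk1 Hk HL); fold c0 in H.
  assert (Hsl : 0 < sqrt ln_n) by now apply sqrt_lt_R0.
  (* With L exactly ln n / ln q the main term is reproduced without error. *)
  replace (3 * kappa m * INR n / sqrt ln_n) with (3 * (INR n * sqrt (/ (PI * (ln_n / lq))))).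
  2: { replace (/ (PI * (ln_n / lq))) with (lq / PI / ln_n) by (field; lra).
       rewrite sqrt_div_alt by assumption; unfold kappa; fold lq; field; lra. }
  apply Rle_trans with (1 := H).
  replace (c0 * (4 * (lq * sqrt lq)) * (INR n / sqrt ln_n) / ln_n)
    with (c0 * (4 * (lq * sqrt lq) * (INR n / sqrt ln_n) / ln_n)) by (field; lra).
  apply Rmult_le_compat_l; [assumption|].
  assert (Hsk : 0 < sqrt (INR k)) by (apply sqrt_lt_R0; lra).
  assert (Hslq : 0 < sqrt lq) by now apply sqrt_lt_R0.
  assert (Hs : sqrt ln_n <= 2 * (sqrt (INR k) * sqrt lq)).
  { rewrite <- sqrt_mult by lra.
    replace 2 with (sqrt 4) by (replace 4 with (2 * 2) by ring; apply sqrt_square; lra).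
    rewrite <- sqrt_mult by nra; apply sqrt_le_1_alt; nra. }
  assert (Hls : ln_n * sqrt ln_n <= 2 * (INR k * lq) * (2 * (sqrt (INR k) * sqrt lq))).
  { apply Rmult_le_compat; try lra; nra. }
  replace (4 * (lq * sqrt lq) * (INR n / sqrt ln_n) / ln_n)
    with (INR n * (4 * (lq * sqrt lq) / (ln_n * sqrt ln_n))) by (field; lra).
  apply Rmult_le_compat_l; [lra|].
  apply (Rmult_le_reg_r (INR k * sqrt (INR k) * (ln_n * sqrt ln_n))).
  - apply Rmult_lt_0_compat; apply Rmult_lt_0_compat; lra.
  - replace (/ (INR k * sqrt (INR k)) * (INR k * sqrt (INR k) * (ln_n * sqrt ln_n)))
      with (ln_n * sqrt ln_n) by (field; lra).
    replace (4 * (lq * sqrt lq) / (ln_n * sqrt ln_n) * (INR k * sqrt (INR k) * (ln_n * sqrt ln_n)))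
      with (2 * (INR k * lq) * (2 * (sqrt (INR k) * sqrt lq))) by (field; lra).
    exact Hls.
Qed.
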